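(* Let $X$ be a one-sided shift space over a finite alphabet $\mathfrak a$, with shift map $\sigma$. The $C^*$-algebra $\mathcal D_X\rtimes_{\alpha,\mathcal L}\mathbb N$ is the universal $C^*$-algebra generated by partial isometries $\{S_u\}_{u\in\mathfrak a^*}$ satisfying: (1) $S_uS_v=S_{uv}$ for all $u,v\in\mathfrak a^*$; (2) the map $1_{C(u,v)}\mapsto S_vS_u^*S_uS_v^*$, $u,v\in\mathfrak a^*$, extends to a $*$-homomorphism from $\mathcal D_X$ to $C^*(S_u\mid u\in\mathfrak a^* )$. That is, $\mathcal D_X\rtimes_{\alpha,\mathcal L}\mathbb N$ is generated by partial isometries $\{S_u\}_{u\in\mathfrak a^*}$ satisfying (1) and (2), and whenever $B$ is a $C^*$-algebra generated by partial isometries $\{s_u\}_{u\in\mathfrak a^*}$ satisfying (1) and (2) (with $s_u$ in place of $S_u$), there is a $*$-homomorphism $\mathcal D_X\rtimes_{\alpha,\mathcal L}\mathbb N\to B$ sending $S_u$ to $s_u$ for every $u\in\mathfrak a^*$.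
   Context: **Shift spaces.** $\mathfrak a$ is a finite set with the discrete topology, $\mathbb N_0=\{0,1,2,\dots\}$, and $\mathfrak a^{\mathbb N_0}$ has the product topology. The shift is $(\sigma(x))_i=x_{i+1}$. A one-sided shift space is a closed subset $X\subseteq\mathfrak a^{\mathbb N_0}$ with $\sigma(X)\subseteq X$ (not necessarily equal); $\sigma$ also denotes its restriction to $X$. $\mathfrak a^*$ is the set of all finite words over $\mathfrak a$, including the empty word $\epsilon$; $|u|$ is the length of $u$. For $u,v\in\mathfrak a^*$, $C(u,v)=\{vx\in X\mid x\in\mathfrak a^{\mathbb N_0},\ ux\in X\}$. $1_Y$ denotes the characteristic function of $Y\subseteq X$. **The algebra $\mathcal D_X$.** For bounded functions $f:X\to\mathbb C$ put $\alpha(f)=f\circ\sigma$ and $\mathcal L(f)(x)=\frac1{\#\sigma^{-1}(\{x\})}\sum_{y\in\sigma^{-1}(\{x\})}f(y)$ if $x\in\sigma(X)$, $\mathcal L(f)(x)=0$ if $x\notin\sigma(X)$. $\mathcal D_X$ is the smallest $C^*$-subalgebra of the $C^*$-algebra of bounded functions on $X$ that contains $C(X)$ and is closed under $\mathcal L$ and $\alpha$. ($\mathcal D_X$ is generated as a $C^*$-algebra by $\{1_{C(u,v)}\}_{u,v\in\mathfrak a^*}$.) **Exel's crossed product.** Let $A$ be a unital $C^*$-algebra, $\alpha:A\to A$ a $*$-endomorphism, and $\mathcal L:A\to A$ a transfer operator, i.e. a continuous positive linear map with $\mathcal L(\alpha(a)b)=a\mathcal L(b)$ for all $a,b\in A$.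 $\mathcal T(A,\alpha,\mathcal L)$ is the universal unital $C^*$-algebra generated by a copy of $A$ and an element $S$ subject to $Sa=\alpha(a)S$ and $S^*aS=\mathcal L(a)$ for all $a\in A$; the canonical map from $A$ is injective. A redundancy is a pair $(a,k)\in A\times\overline{ASS^*A}$ (closed linear span) with $abS=kbS$ for all $b\in A$. The crossed product $A\rtimes_{\alpha,\mathcal L}\mathbb N$ is the quotient of $\mathcal T(A,\alpha,\mathcal L)$ by the closed two-sided ideal generated by all differences $a-k$, where $(a,k)$ is a redundancy with $a\in\overline{A\alpha(A)A}$. *)

(* Defs.v *)
From HB Require Import structures.
From mathcomp Require Import all_boot all_order all_algebra finmap.
From mathcomp Require Import all_classical reals topology normedtype.
From mathcomp Require Import complex.
From mathcomp Require Import ring lra.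
Set Implicit Arguments.
Unset Strict Implicit.
Unset Printing Implicit Defensive.
Import Order.TTheory GRing.Theory Num.Theory numFieldNormedType.Exports.
Local Open Scope classical_set_scope.
Local Open Scope ring_scope.
Local Open Scope complex_scope.

(* No unit is required, so that the zero algebra is included; the norm takes its
   values in the (partially ordered) field R[i], as for every normedModType. *)
HB.mixin Record isCStarAlgebra (R : realType) A
    & CompleteNormedModule R[i] A := {
  cmul : A -> A -> A ;
  star : A -> A ;
  cmulA : associative cmul ;
  cmulDl : left_distributive cmul +%R ;
  cmulDr : right_distributive cmul +%R ;
  cmulZl : forall (k : R[i]) (a b : A), cmul (k *: a) b = k *: cmul a b ;
  cmulZr : forall (k : R[i]) (a b : A), cmul a (k *: b) = k *: cmul a b ;
  starD : {morph star : a b / a + b} ;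
  starZ : forall (k : R[i]) (a : A), star (k *: a) = k^* *: star a ;
  starM : forall a b : A, star (cmul a b) = cmul (star b) (star a) ;
  starK : involutive star ;
  cnormM : forall a b : A, `|cmul a b| <= `|a| * `|b| ;
  cstar_id : forall a : A, `|cmul (star a) a| = `|a| ^+ 2
}.

#[short(type="cstarType")]
HB.structure Definition CStarAlgebra (R : realType) :=
  {A of CompleteNormedModule R[i] A & isCStarAlgebra R A}.

Notation "a ** b" := (cmul a b) (at level 40, left associativity) : ring_scope.

Section Basics.
Context {R : realType}.
Implicit Types A B : cstarType R.

Definition cstar_subalg A (S : set A) : Prop :=
  [/\ closed S,
      S 0 /\ (forall a b, S a -> S b -> S (a + b)),
      forall (k : R[i]) a, S a -> S (k *: a),
      forall a b, S a -> S b -> S (a ** b) &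
      forall a, S a -> S (star a)].

(* C*-subalgebra generated by G; it need not contain a unit of A. *)
Definition cstar_gen A (G : set A) : set A := smallest (@cstar_subalg A) G.

Definition lin_closed A (V : set A) : Prop :=
  [/\ closed V, V 0 & forall (k : R[i]) a b, V a -> V b -> V (k *: a + b)].

Definition closed_span A (G : set A) : set A := smallest (@lin_closed A) G.

Definition closed_ideal A (J : set A) : Prop :=
  lin_closed J /\ forall a b, J b -> J (a ** b) /\ J (b ** a).

(* No continuity is required: *-homomorphisms of C*-algebras are contractive. *)
Definition star_hom A B (f : A -> B) : Prop :=
  [/\ linear f, {morph f : a b / a ** b} & {morph f : a / star a}].

Definition is_cunit A (e : A) : Prop := forall a, e ** a = a /\ a ** e = a.

Definition cstar_pos A (a : A) : Prop := exists b, a = star b ** b.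

Definition partial_isometry A (s : A) : Prop := s ** star s ** s = s.

End Basics.

Section SubAlgebra.
Context {R : realType} {A : cstarType R}.

Record csub := CSub { csub_set :> set A ; csubP : cstar_subalg csub_set }.

Definition csub_pred (S : csub) : {pred A} := fun a => a \in csub_set S.
Definition csub_type (S : csub) : Type := {a : A | a \in csub_pred S}.
Variable S : csub.
Local Notation B := (csub_type S).

Lemma csub_predE a : (a \in csub_pred S) = (a \in csub_set S).
Proof. by []. Qed.

Lemma csub_submod : submod_closed (csub_pred S).
Proof.
have [_ [S0 SD] SZ _ _] := csubP S; split; first by rewrite csub_predE inE.
by move=> k a b; rewrite !csub_predE !inE => Sa Sb; apply: SD => //; apply: SZ.
Qed.

HB.instance Definition _ := GRing.isSubmodClosed.Build R[i] A (csub_pred S)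
  csub_submod.
HB.instance Definition _ := SubChoice.on B.
HB.instance Definition _ := [SubChoice_isSubLmodule of B by <:].

Lemma csub_normD (x y : B) : `|val (x + y)| <= `|val x| + `|val y|.
Proof. exact: ler_normD. Qed.
Lemma csub_normZ (l : R[i]) (x : B) : `|val (l *: x)| = `|l| * `|val x|.
Proof. exact: normrZ. Qed.
Lemma csub_norm0 (x : B) : `|val x| = 0 -> x = 0.
Proof. by move/normr0_eq0 => x0; apply: val_inj; rewrite x0. Qed.

HB.instance Definition _ := Lmodule_isNormed.Build R[i] B
  csub_normD csub_normZ csub_norm0.

Lemma csub_normE (x : B) : `|x| = `|val x|. Proof. by []. Qed.

Lemma csub_complete (F : set_system B) : ProperFilter F -> cauchy F -> cvg F.
Proof.
move=> FF /cauchy_ballP Fc.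
have : cauchy (val @ F : set_system A).
  apply/cauchy_ballP => e e0; have [[P Q] /= [FP FQ] PQ] := Fc e e0.
  exists (val @` P, val @` Q) => /=.
    by split; [apply: filterS FP|apply: filterS FQ] => x Px; exists x.
  move=> [_ _] /= [[x Px <-] [y Qy <-]].
  by have := PQ (x, y) (conj Px Qy); rewrite /= -!ball_normE.
move=> /cauchy_cvg; move=> /cvg_ex[l Fl].
have Sl : csub_set S l.
  have [Scl _ _ _ _] := csubP S.
  have FS : \forall x \near F, csub_set S (val (x : B)).
    by apply: nearW => x; apply: set_mem; exact: (valP x).
  exact: (@closed_cvg _ _ F FF val (csub_set S) Scl FS l Fl).
apply/cvg_ex; exists (exist _ l (mem_set Sl) : B).
apply/cvgrPdist_lt => e e0; move/cvgrPdist_lt: Fl => /(_ e e0).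
by apply: filterS => x.
Qed.

HB.instance Definition _ := Uniform_isComplete.Build B csub_complete.

Lemma csub_mulP (x y : B) : val x ** val y \in csub_pred S.
Proof.
have [_ _ _ SM _] := csubP S; rewrite csub_predE inE.
by apply: SM; apply: set_mem; exact: valP.
Qed.
Lemma csub_starP (x : B) : star (val x) \in csub_pred S.
Proof.
have [_ _ _ _ Ss] := csubP S; rewrite csub_predE inE.
by apply: Ss; apply: set_mem; exact: valP.
Qed.
Definition csub_mul (x y : B) : B :=
  exist (fun a => a \in csub_pred S) _ (csub_mulP x y).
Definition csub_star (x : B) : B :=
  exist (fun a => a \in csub_pred S) _ (csub_starP x).

Let mulA : associative csub_mul.
Proof. by move=> x y z; apply: val_inj; exact: cmulA. Qed.
Let mulDl : left_distributive csub_mul +%R.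
Proof. by move=> x y z; apply: val_inj; exact: cmulDl. Qed.
Let mulDr : right_distributive csub_mul +%R.
Proof. by move=> x y z; apply: val_inj; exact: cmulDr. Qed.
Let mulZl (k : R[i]) (x y : B) : csub_mul (k *: x) y = k *: csub_mul x y.
Proof. by apply: val_inj; exact: cmulZl. Qed.
Let mulZr (k : R[i]) (x y : B) : csub_mul x (k *: y) = k *: csub_mul x y.
Proof. by apply: val_inj; exact: cmulZr. Qed.
Let stD : {morph csub_star : x y / x + y}.
Proof. by move=> x y; apply: val_inj; exact: starD. Qed.
Let stZ (k : R[i]) (x : B) : csub_star (k *: x) = k^* *: csub_star x.
Proof. by apply: val_inj; exact: starZ. Qed.
Let stM (x y : B) : csub_star (csub_mul x y) = csub_mul (csub_star y) (csub_star x).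
Proof. by apply: val_inj; exact: starM. Qed.
Let stK : involutive csub_star.
Proof. by move=> x; apply: val_inj; exact: starK. Qed.
Let nM (x y : B) : `|csub_mul x y| <= `|x| * `|y|.
Proof. exact: cnormM. Qed.
Let nS (x : B) : `|csub_mul (csub_star x) x| = `|x| ^+ 2.
Proof. exact: cstar_id. Qed.

HB.instance Definition _ := isCStarAlgebra.Build R B
  mulA mulDl mulDr mulZl mulZr stD stZ stM stK nM nS.

Lemma csub_linE (k : R[i]) (f g : B) : val (k *: f + g) = k *: val f + val g.
Proof. by []. Qed.
Lemma csub_mulE (f g : B) : val (f ** g) = val f ** val g.
Proof. by []. Qed.
Lemma csub_starE (f : B) : val (star f) = star (val f).
Proof. by []. Qed.

End SubAlgebra.
Arguments csub {R} A.

Section BigcapSub.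
Context {R : realType} {A : cstarType R}.

Lemma cstar_subalg_bigcap (P : set (set A)) :
  (forall S, P S -> cstar_subalg S) -> cstar_subalg (\bigcap_(S in P) S).
Proof.
move=> PS; split.
- by apply: closed_bigI => S /PS[].
- split; first by move=> S /PS[_ []].
  move=> a b Sa Sb S PS'; have [_ [_ SD] _ _ _] := PS _ PS'.
  by apply: SD; [exact: Sa|exact: Sb].
- by move=> k a Sa S PS'; have [_ _ SZ _ _] := PS _ PS'; apply: SZ; exact: Sa.
- move=> a b Sa Sb S PS'; have [_ _ _ SM _] := PS _ PS'.
  by apply: SM; [exact: Sa|exact: Sb].
- by move=> a Sa S PS'; have [_ _ _ _ Ss] := PS _ PS'; apply: Ss; exact: Sa.
Qed.

End BigcapSub.

Section ComplexNorm.
Context {R : realType}.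
Implicit Types (x y : R[i]) (r : R).
Local Notation normc := (@Normc.normc R).

Lemma normcC x : `|x| = (normc x)%:C.
Proof. by []. Qed.

Lemma normc_ge0 x : 0 <= normc x.
Proof. by rewrite -lecR; exact: (@normr_ge0 _ R[i]). Qed.

Lemma ler_normcD x y : normc (x + y) <= normc x + normc y.
Proof. by rewrite -lecR rmorphD /=; exact: (@ler_normD _ R[i]). Qed.

Lemma complex_complete (F : set_system R[i]^o) :
  ProperFilter F -> cauchy F -> cvg F.
Proof.
move=> FF /cauchy_ballP Fc.
have part (g : R[i] -> R) : (forall x y, `|g x - g y| <= normc (x - y)) ->
    exists l : R, forall e : R, 0 < e -> \forall x \near F, `|l - g x| < e.
  move=> gn.
  have /cauchy_cvg/cvg_ex[l Fl] : cauchy (g @ F : set_system R).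
    apply/cauchy_ballP => e e0.
    have e0' : 0 < e%:C by rewrite ltcR.
    have [[P Q] /= [FP FQ] PQ] := Fc e%:C e0'.
    exists (g @` P, g @` Q) => /=.
      by split; [apply: filterS FP|apply: filterS FQ] => x Px; exists x.
    move=> [_ _] /= [[x Px <-] [y Qy <-]].
    have := PQ (x, y) (conj Px Qy); rewrite /= -!ball_normE /= normcC ltcR.
    by apply: le_lt_trans.
  by exists l => e e0; move/cvgrPdist_lt: Fl => /(_ e e0).
have [|a Fa] := part (@complex.Re R).
  by move=> [x x'] [y y'] /=; rewrite -sqrtr_sqr ler_wsqrtr// lerDl sqr_ge0.
have [|b Fb] := part (@complex.Im R).
  by move=> [x x'] [y y'] /=; rewrite -sqrtr_sqr ler_wsqrtr// lerDr sqr_ge0.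
apply/cvg_ex; exists (a +i* b).
apply/cvgrPdist_lt => e; case: e => e e' /=; rewrite ltcE /= => /andP[/eqP -> e0].
have e20 : 0 < e / 2 by rewrite divr_gt0.
apply: filterS2 (Fa _ e20) (Fb _ e20) => -[x y] /= xa yb.
have -> : (a +i* b) - (x +i* y) = (a - x)%:C + 'i * (b - y)%:C :> R[i].
  by simpc.
rewrite normcC -/(e%:C) ltcR.
apply: le_lt_trans (ler_normcD _ _) _.
rewrite Normc.normcM /= !expr0n /= !expr1n !addr0 add0r sqrtr1 mul1r.
by rewrite !sqrtr_sqr [ltRHS]splitr ltrD.
Qed.

End ComplexNorm.

Section Linfty.
Context {R : realType} (T : Type).
Local Notation normc := (@Normc.normc R).

(* Bounded functions with the supremum norm; sup set0 = 0, so linfty R T is the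
   zero algebra when T is empty. *)
Definition linfty_pred : {pred T -> R[i]} :=
  fun f => `[< exists M : R, forall x, normc (f x) <= M >].
Definition linfty : Type := {f : T -> R[i] | f \in linfty_pred}.

Lemma linfty_predP (f : T -> R[i]) :
  reflect (exists M : R, forall x, normc (f x) <= M) (f \in linfty_pred).
Proof. exact: asboolP. Qed.

Lemma linfty_submod : submod_closed linfty_pred.
Proof.
split; first by apply/linfty_predP; exists 0 => x; rewrite Normc.normc0.
move=> k f g /linfty_predP[M fM] /linfty_predP[N gN]; apply/linfty_predP.
exists (normc k * M + N) => x; apply: le_trans (ler_normcD _ _) _.
by apply: lerD => //; rewrite Normc.normcM ler_wpM2l// normc_ge0.
Qed.

HB.instance Definition _ := GRing.isSubmodClosed.Build R[i] (T -> R[i])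
  linfty_pred linfty_submod.
HB.instance Definition _ := SubChoice.on linfty.
HB.instance Definition _ := [SubChoice_isSubLmodule of linfty by <:].

Definition mk_linfty (f : T -> R[i]) (fb : f \in linfty_pred) : linfty :=
  exist (fun g => g \in linfty_pred) f fb.

Definition supnorm (f : linfty) : R := sup (range (fun x => normc (val f x))).

Lemma supnorm_ub (f : linfty) x : normc (val f x) <= supnorm f.
Proof.
have /linfty_predP[M fM] := valP f.
by apply: ub_le_sup; [exists M => _ [y _ <-]|exists x].
Qed.

Lemma supnorm_ge0 (f : linfty) : 0 <= supnorm f.
Proof.
have [[x]|T0] := pselect (inhabited T).
  by apply: le_trans (supnorm_ub f x); exact: normc_ge0.
rewrite /supnorm; have -> : range (fun x => normc (val f x)) = set0.
  by apply/seteqP; split => // y [x _ _]; case: T0.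
by rewrite sup0.
Qed.

Lemma supnorm_le (f : linfty) (M : R) :
  0 <= M -> (forall x, normc (val f x) <= M) -> supnorm f <= M.
Proof.
move=> M0 fM; have [[x]|T0] := pselect (inhabited T).
  by apply: ge_sup; [exists (normc (val f x)), x|move=> _ [y _ <-]].
rewrite /supnorm; have -> : range (fun x => normc (val f x)) = set0.
  by apply/seteqP; split => // y [x _ _]; case: T0.
by rewrite sup0.
Qed.

Lemma linftyP (f g : linfty) : (forall x, val f x = val g x) -> f = g.
Proof. by move=> fg; apply: val_inj; apply/funext. Qed.

Let normD (f g : linfty) :
  (supnorm (f + g))%:C <= (supnorm f)%:C + (supnorm g)%:C.
Proof.
rewrite -raddfD /= lecR; apply: supnorm_le.
  by rewrite addr_ge0 ?supnorm_ge0.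
move=> x; apply: le_trans (ler_normcD _ _) _.
by apply: lerD; exact: supnorm_ub.
Qed.

Let normZ (k : R[i]) (f : linfty) :
  (supnorm (k *: f))%:C = `|k| * (supnorm f)%:C.
Proof.
rewrite normcC -rmorphM /=; congr (_%:C).
have le_k (l : R[i]) (g : linfty) : supnorm (l *: g) <= normc l * supnorm g.
  apply: supnorm_le; first by rewrite mulr_ge0 ?supnorm_ge0 ?normc_ge0.
  by move=> x; rewrite Normc.normcM ler_wpM2l ?normc_ge0 ?supnorm_ub.
apply/eqP; rewrite eq_le le_k /=.
have [->|k0] := eqVneq k 0; first by rewrite Normc.normc0 mul0r supnorm_ge0.
have nk0 : 0 < normc k.
  rewrite lt_def normc_ge0 andbT; apply: contra k0.
  by move=> /eqP /Normc.eq0_normc ->.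
have := le_k k^-1 (k *: f); rewrite scalerA mulVf// scale1r Normc.normcV.
by rewrite ler_pdivlMl.
Qed.

Let norm0 (f : linfty) : (supnorm f)%:C = 0 -> f = 0.
Proof.
move=> [f0]; apply: linftyP => x; apply: Normc.eq0_normc.
by apply/eqP; rewrite eq_le normc_ge0 andbT -f0 supnorm_ub.
Qed.

HB.instance Definition _ := Lmodule_isNormed.Build R[i] linfty normD normZ norm0.

Lemma linfty_normE (f : linfty) : `|f| = (supnorm f)%:C. Proof. by []. Qed.

Lemma linfty_complete (F : set_system linfty) :
  ProperFilter F -> cauchy F -> cvg F.
Proof.
move=> FF /cauchy_ballP Fc.
have Fr (e : R) : 0 < e -> exists P : set linfty,
    F P /\ forall f g x, P f -> P g -> normc (val f x - val g x) < e.
  move=> e0; have e0' : 0 < e%:C by rewrite ltcR.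
  have [[P Q] /= [FP FQ] PQ] := Fc e%:C e0'.
  exists (P `&` Q); split; first exact: filterI.
  move=> f g x [Pf _] [_ Qg]; have := PQ (f, g) (conj Pf Qg).
  rewrite /= -ball_normE /= linfty_normE ltcR; apply: le_lt_trans.
  exact: (supnorm_ub (f - g) x).
have Fx (x : T) : exists l : R[i], forall e : R, 0 < e ->
    \forall f \near F, normc (l - val f x) < e.
  have : cauchy ((fun f : linfty => (val f x : R[i]^o)) @ F).
    apply/cauchy_ballP => -[e e']; rewrite ltcE /= => /andP[/eqP -> e0].
    have [P [FP PP]] := Fr e e0.
    pose h := fun f : linfty => (val f x : R[i]^o).
    have FhP : F (h @^-1` (h @` P)) by apply: filterS FP => f Pf; exists f.
    exists (h @` P, h @` P) => //=.
    move=> [_ _] /= [[f Pf <-] [g Pg <-]].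
    by rewrite -ball_normE /= normcC -/(e%:C) ltcR PP.
  move=> /complex_complete /cvg_ex[l Fl].
  exists l => e e0; have e0' : 0 < e%:C by rewrite ltcR.
  move/cvgrPdist_lt: Fl => /(_ _ e0'); apply: filterS => f.
  by rewrite normcC ltcR.
pose l x := sval (cid (Fx x)).
have lP x (e : R) : 0 < e -> \forall f \near F, normc (l x - val f x) < e.
  by rewrite /l; case: cid => /= z; apply.
have Fl (e : R) : 0 < e -> exists P : set linfty,
    F P /\ forall f x, P f -> normc (l x - val f x) < e.
  move=> e0; have e20 : 0 < e / 2 by rewrite divr_gt0.
  have [P [FP PP]] := Fr _ e20; exists P; split=> // f x Pf.
  have [g [Pg lg]] : exists g, P g /\ normc (l x - val g x) < e / 2.
    have FI : F (P `&` [set g | normc (l x - val g x) < e / 2]).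
      by apply: filterI => //; exact: lP.
    by have [g []] := filter_ex FI; exists g.
  rewrite -(subrK (val g x) (l x)) -addrA; apply: le_lt_trans (ler_normcD _ _) _.
  by rewrite [ltRHS]splitr ltrD// PP.
have lb : l \in linfty_pred.
  have [P [FP PP]] := Fl 1 ltr01.
  have [f Pf] := filter_ex FP; apply/linfty_predP; exists (1 + supnorm f) => x.
  rewrite -(subrK (val f x) (l x)); apply: le_trans (ler_normcD _ _) _.
  by rewrite lerD ?supnorm_ub// ltW// PP.
apply/cvg_ex; exists (mk_linfty lb).
apply/cvgrPdist_lt => -[e e']; rewrite ltcE /= => /andP[/eqP -> e0].
have e20 : 0 < e / 2 by rewrite divr_gt0.
have [P [FP PP]] := Fl _ e20; apply: filterS FP => f Pf.
rewrite linfty_normE -/(e%:C) ltcR; apply: le_lt_trans (_ : e / 2 < e).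
  by apply: supnorm_le; [exact: ltW|move=> x; exact/ltW/PP].
by rewrite ltr_pdivrMr// ltr_pMr// ltr1n.
Qed.

HB.instance Definition _ := Uniform_isComplete.Build linfty linfty_complete.

Lemma linfty_mulP (f g : linfty) : (fun x => val f x * val g x) \in linfty_pred.
Proof.
apply/linfty_predP; exists (supnorm f * supnorm g) => x.
by rewrite Normc.normcM ler_pM ?normc_ge0 ?supnorm_ub.
Qed.
Lemma normc_conj (x : R[i]) : normc x^* = normc x.
Proof. by case: x => a b; rewrite /= sqrrN. Qed.
Lemma linfty_starP (f : linfty) : (fun x => (val f x)^*) \in linfty_pred.
Proof.
by apply/linfty_predP; exists (supnorm f) => x; rewrite normc_conj supnorm_ub.
Qed.
Definition linfty_mul (f g : linfty) : linfty := mk_linfty (linfty_mulP f g).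
Definition linfty_star (f : linfty) : linfty := mk_linfty (linfty_starP f).

Let mulA : associative linfty_mul.
Proof. by move=> f g h; apply: linftyP => x; exact: mulrA. Qed.
Let mulDl : left_distributive linfty_mul +%R.
Proof. by move=> f g h; apply: linftyP => x; exact: mulrDl. Qed.
Let mulDr : right_distributive linfty_mul +%R.
Proof. by move=> f g h; apply: linftyP => x; exact: mulrDr. Qed.
Let mulZl (k : R[i]) (f g : linfty) :
  linfty_mul (k *: f) g = k *: linfty_mul f g.
Proof. by apply: linftyP => x; rewrite /= [LHS]/= -mulrA. Qed.
Let mulZr (k : R[i]) (f g : linfty) :
  linfty_mul f (k *: g) = k *: linfty_mul f g.
Proof. by apply: linftyP => x; exact: mulrCA. Qed.
Let stD : {morph linfty_star : f g / f + g}.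
Proof. by move=> f g; apply: linftyP => x; exact: rmorphD. Qed.
Let stZ (k : R[i]) (f : linfty) : linfty_star (k *: f) = k^* *: linfty_star f.
Proof. by apply: linftyP => x; exact: rmorphM. Qed.
Let stM (f g : linfty) :
  linfty_star (linfty_mul f g) = linfty_mul (linfty_star g) (linfty_star f).
Proof. by apply: linftyP => x; rewrite /= rmorphM mulrC. Qed.
Let stK : involutive linfty_star.
Proof. by move=> f; apply: linftyP => x; exact: conjcK. Qed.
Let nM (f g : linfty) : `|linfty_mul f g| <= `|f| * `|g|.
Proof.
rewrite !linfty_normE -rmorphM lecR; apply: supnorm_le.
  by rewrite mulr_ge0 ?supnorm_ge0.
by move=> x; rewrite Normc.normcM ler_pM ?normc_ge0 ?supnorm_ub.
Qed.
Let nS (f : linfty) : `|linfty_mul (linfty_star f) f| = `|f| ^+ 2.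
Proof.
rewrite !linfty_normE -rmorphXn; congr (_%:C); apply/eqP.
rewrite eq_le; apply/andP; split.
  apply: supnorm_le; first by rewrite exprn_ge0 ?supnorm_ge0.
  by move=> x; rewrite Normc.normcM normc_conj ler_pM ?normc_ge0 ?supnorm_ub.
set g := linfty_mul _ _.
rewrite -[leRHS]sqr_sqrtr ?supnorm_ge0// ler_pXn2r ?nnegrE ?supnorm_ge0 ?sqrtr_ge0//.
apply: supnorm_le; first exact: sqrtr_ge0.
move=> x; rewrite -[leLHS]ger0_norm ?normc_ge0// -sqrtr_sqr ler_wsqrtr//.
by have := supnorm_ub g x; rewrite /= Normc.normcM normc_conj.
Qed.

HB.instance Definition _ := isCStarAlgebra.Build R linfty
  mulA mulDl mulDr mulZl mulZr stD stZ stM stK nM nS.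

Lemma linfty_linE (k : R[i]) (f g : linfty) x :
  val (k *: f + g) x = k * val f x + val g x.
Proof. by []. Qed.
Lemma linfty_mulE (f g : linfty) x : val (f ** g) x = val f x * val g x.
Proof. by []. Qed.
Lemma linfty_starE (f : linfty) x : val (star f) x = (val f x)^*.
Proof. by []. Qed.

End Linfty.
Arguments linfty : clear implicits.

Section Shift.
Context {a : finType}.

Definition onesided : Type := prod_topology (fun _ : nat => discrete_topology a).
HB.instance Definition _ := Topological.on onesided.

Definition shift_map (x : onesided) : onesided := fun i => x i.+1.

Definition scons (c : a) (x : onesided) : onesided :=
  fun i => if i is j.+1 then x j else c.

Definition wcat (u : seq a) (x : onesided) : onesided := foldr scons x u.

Record shift_space := ShiftSpace {
  shift_set :> set onesided ;
  shift_closed : closed shift_set ;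
  shift_sub : shift_map @` shift_set `<=` shift_set
}.

Variable X : shift_space.

Lemma shift_onP (x : X) : shift_set X (shift_map (val x)).
Proof. by apply: shift_sub; exists (val x) => //; exact: set_mem (valP x). Qed.

Definition shift_on (x : X) : X :=
  exist (fun y => y \in shift_set X) (shift_map (val x)) (mem_set (shift_onP x)).

(* The set C(u, v) = {v x in X | u x in X}. *)
Definition cyl (u v : seq a) : set X :=
  [set z : X | exists x : onesided, val z = wcat v x /\ shift_set X (wcat u x)].

Definition fiber (x : X) : set X := shift_on @^-1` [set x].

Lemma fiber_inj (x : X) :
  {in fiber x &, injective (fun y : X => (val y 0%N : a))}.
Proof.
move=> y z; rewrite !inE /fiber /= => yx zx yz; apply: val_inj.
have /(congr1 val) /= yz' : shift_on y = shift_on z by rewrite yx zx.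
by apply/funext => -[|n]; [exact: yz|exact: (congr1 (fun w => w n) yz')].
Qed.

Lemma fiber_finite (x : X) : finite_set (fiber x).
Proof.
rewrite -(eq_finite_set (inj_card_eq (@fiber_inj x))).
exact: finite_finset.
Qed.

Lemma fiber_card (x : X) : (#|` fset_set (fiber x)| <= #|a|)%N.
Proof.
pose g := fun y : X => (val y 0%N : a).
have u : uniq (map g (fset_set (fiber x))).
  rewrite map_inj_in_uniq ?fset_uniq// => y z.
  rewrite !in_fset_set; [|exact: fiber_finite..].
  exact: fiber_inj.
rewrite -(size_map g (fset_set (fiber x))) -(card_uniqP u).
exact: max_card.
Qed.

End Shift.
Arguments onesided : clear implicits.
Arguments shift_space : clear implicits.
Arguments shift_on {a X} x.

Section Operators.
Context {R : realType} {a : finType} (X : shift_space a).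
Local Notation normc := (@Normc.normc R).
Local Notation B := (linfty R X).

(* The fibers of shift_on are finite (fiber_finite), so the finitely supported
   sum below is the sum over the whole fiber. *)
Definition transfer_fun (f : X -> R[i]) (x : X) : R[i] :=
  if x \in range (@shift_on a X)
  then (#|` fset_set (shift_on @^-1` [set x])|%:R)^-1 *
       \sum_(y \in shift_on @^-1` [set x]) f y
  else 0.

Lemma transfer_funE f x : transfer_fun f x =
  (#|` fset_set (fiber x)|%:R)^-1 * \sum_(y <- fset_set (fiber x)) f y.
Proof.
rewrite /transfer_fun -/(fiber x); case: ifPn => [_|xr].
  by rewrite fsbig_finite//; exact: fiber_finite.
have -> : fiber x = set0.
  apply/seteqP; split => // y yx; case/negP: xr; rewrite inE.
  by exists y.
by rewrite fset_set0 big_seq_fset0 mulr0.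
Qed.

Lemma endo_funP (f : B) : val f \o @shift_on a X \in @linfty_pred R X.
Proof. by apply/linfty_predP; exists (supnorm f) => x; exact: supnorm_ub. Qed.

Definition endo_linfty (f : B) : B := mk_linfty (endo_funP f).

Lemma transfer_fun_le (f : B) x : normc (transfer_fun (val f) x) <= supnorm f.
Proof.
rewrite -lecR -[leLHS]/(`|transfer_fun (val f) x|) transfer_funE normrM normfV.
set s := fset_set _; rewrite normr_nat.
have [s0|s0] := posnP #|` s|.
  by rewrite s0 invr0 mul0r lecR supnorm_ge0.
rewrite ler_pdivrMl ?ltr0n//; apply: le_trans (ler_norm_sum _ _ _) _.
apply: (@le_trans _ _ (\sum_(y <- s) (supnorm f)%:C)).
  by apply: ler_sum => y _; rewrite normcC lecR supnorm_ub.
by rewrite big_const_seq count_predT iter_addr addr0 mulr_natl.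
Qed.

Lemma transfer_funP (f : B) : transfer_fun (val f) \in @linfty_pred R X.
Proof. by apply/linfty_predP; exists (supnorm f); exact: transfer_fun_le. Qed.

Definition transfer_linfty (f : B) : B := mk_linfty (transfer_funP f).

Definition contX : set B := [set f | continuous (val f : X -> R[i]^o)].

Definition DX_prop (S : set B) : Prop :=
  [/\ cstar_subalg S,
      forall f, S f -> S (endo_linfty f) &
      forall f, S f -> S (transfer_linfty f)].

Definition DX_set : set B := smallest DX_prop contX.

Lemma DX_subalg : cstar_subalg DX_set.
Proof. by apply: cstar_subalg_bigcap => S [[]]. Qed.

Lemma DX_endo f : DX_set f -> DX_set (endo_linfty f).
Proof. by move=> Df S SP; have [[_ Sa _] _] := SP; exact/Sa/(Df S SP). Qed.

Lemma DX_transfer f : DX_set f -> DX_set (transfer_linfty f).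
Proof. by move=> Df S SP; have [[_ _ Sa] _] := SP; exact/Sa/(Df S SP). Qed.

Lemma DX_cont f : contX f -> DX_set f.
Proof. by move=> Cf S [_]; exact. Qed.

Definition DX : cstarType R := csub_type (CSub DX_subalg).

Definition mkDX (f : B) (Df : DX_set f) : DX :=
  exist (fun g => g \in csub_pred (CSub DX_subalg)) f (mem_set Df).

Lemma DXvalP (f : DX) : DX_set (val f). Proof. exact: set_mem (valP f). Qed.

Definition alphaX (f : DX) : DX := mkDX (DX_endo (DXvalP f)).
Definition transferX (f : DX) : DX := mkDX (DX_transfer (DXvalP f)).

End Operators.
Arguments DX R {a} X.
Arguments DX_set R {a} X.

Section DXmembers.
Context {R : realType} {a : finType} (X : shift_space a).
Local Notation normc := (@Normc.normc R).
Local Notation B := (linfty R X).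
Local Notation D := (DX_set R X).
Implicit Types f g : B.

Lemma onelinfP : (fun _ : X => 1 : R[i]) \in @linfty_pred R X.
Proof. by apply/linfty_predP; exists 1 => _; rewrite Normc.normc1. Qed.
Definition onelinf : B := mk_linfty onelinfP.

Lemma DX_add f g : D f -> D g -> D (f + g).
Proof. by have [_ [_ H] _ _ _] := DX_subalg (R := R) X; exact: H. Qed.
Lemma DX_scale (k : R[i]) f : D f -> D (k *: f).
Proof. by have [_ _ H _ _] := DX_subalg (R := R) X; exact: H. Qed.
Lemma DX_mul f g : D f -> D g -> D (f ** g).
Proof. by have [_ _ _ H _] := DX_subalg (R := R) X; exact: H. Qed.
Lemma DX_zero : D 0.
Proof. by have [_ [H _] _ _ _] := DX_subalg (R := R) X. Qed.
Lemma DX_sub f g : D f -> D g -> D (f - g).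
Proof. by move=> Df Dg; rewrite -scaleN1r; apply: DX_add => //; exact: DX_scale. Qed.

Lemma DX_one : D onelinf.
Proof. by apply: DX_cont => x; exact: cst_continuous. Qed.

Lemma DX_closure f :
  (forall e : R, 0 < e -> exists2 g, D g & forall x, normc (val f x - val g x) < e) ->
  D f.
Proof.
move=> fg; have [Dcl _ _ _ _] := DX_subalg (R := R) X; apply: Dcl => U.
rewrite -nbhs_ballE => -[[e e'] /=]; rewrite ltcE /= => /andP[/eqP -> e0 eU].
have [g Dg ge] := fg _ (divr_gt0 e0 (ltr0Sn R 1)).
exists g; split=> //; apply: eU; rewrite -ball_normE /=.
rewrite linfty_normE -/(e%:C) ltcR; apply: (@le_lt_trans _ _ (e / 2)).
  by apply: supnorm_le; [by rewrite divr_ge0 ?(ltW e0)|move=> x; exact/ltW/ge].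
by rewrite ltr_pdivrMr// ltr_pMr// ltr1n.
Qed.

(* The iteration p_{n+1} = p_n + (h - p_n^2)/2 converges uniformly to the square
   root of h when 0 <= h <= 1; it is used to show that the transfer operator is
   positive on DX. *)
Fixpoint sqrt_it (h : B) n : B := if n is m.+1
  then sqrt_it h m + (2^-1 : R)%:C *: (h - sqrt_it h m ** sqrt_it h m) else 0.

Lemma sqrt_itD h n : D h -> D (sqrt_it h n).
Proof.
move=> Dh; elim: n => [|n IH] /=; first exact: DX_zero.
apply: DX_add => //; apply: DX_scale; apply: DX_sub => //; exact: DX_mul.
Qed.

Lemma sqrt_itP h (s : X -> R) n :
  (forall x, val h x = (s x ^+ 2)%:C) -> (forall x, 0 <= s x <= 1) ->
  exists2 p : X -> R, forall x, val (sqrt_it h n) x = (p x)%:C &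
    forall x, 0 <= p x <= s x /\ s x - p x <= 2 / n.+2%:R.
Proof.
move=> hs s01; elim: n => [|n [p pE pP]].
  exists (fun=> 0) => // x; have /andP[s0 s1] := s01 x.
  by rewrite lexx s0 subr0 divff ?pnatr_eq0.
exists (fun x => p x + 2^-1 * (s x ^+ 2 - p x ^+ 2)) => x.
  have -> : val (sqrt_it h n.+1) x = val (sqrt_it h n) x +
     (2^-1)%:C * (val h x - val (sqrt_it h n) x * val (sqrt_it h n) x) by [].
  by rewrite pE hs -rmorphM -rmorphB -rmorphM -rmorphD expr2.
have [/andP[p0 ps] dn] := pP x; have /andP[s0 s1] := s01 x.
move: (p x) (s x) p0 ps dn s0 s1 => {pE pP hs s01}p {}s p0 ps dn s0 s1.
have N0 : 0 < n.+2%:R :> R by rewrite ltr0n.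
rewrite -[n.+3%:R]natr1; set N : R := n.+2%:R in N0 dn *.
have e2 : s ^+ 2 - p ^+ 2 = (s - p) * (s + p) by ring.
rewrite e2; split.
  apply/andP; split.
    by rewrite addr_ge0// mulr_ge0 ?invr_ge0 ?ler0n// mulr_ge0 ?subr_ge0 ?addr_ge0.
  rewrite -subr_ge0 [leRHS](_ : _ = (s - p) * (1 - (s + p) / 2)); last by field.
  rewrite mulr_ge0 ?subr_ge0// ler_pdivrMr// mul1r -[2]/(1 + 1) lerD//.
  exact: le_trans s1.
have N1 : 0 < N + 1 by rewrite addr_gt0.
have N2 : 2 <= N by rewrite /N ler_nat.
have d0 : 0 <= s - p by rewrite subr_ge0.
have -> : s - (p + 2^-1 * ((s - p) * (s + p))) = (s - p) * (1 - (s + p) / 2) by field.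
apply: (@le_trans _ _ ((s - p) * (1 - (s - p) / 2))).
  by apply: ler_wpM2l => //; lra.
set d := s - p in dn d0 *.
set q := 2 / N in dn.
have qN : q * N = 2 by rewrite /q divfK// gt_eqF.
rewrite ler_pdivlMr//.
have q1 : q <= 1 by rewrite /q ler_pdivrMr// mul1r.
apply: (@le_trans _ _ (q * (1 - q / 2) * (N + 1))).
  by rewrite ler_pM2r//; nra.
have -> : q * (1 - q / 2) * (N + 1) = 2 - q ^+ 2 / 2.
  have -> : q * (1 - q / 2) * (N + 1) = (q * N) * (1 - q / 2) + q * (1 - q / 2) by ring.
  by rewrite qN; field.
by rewrite lerBlDr lerDl mulr_ge0 ?sqr_ge0// invr_ge0.
Qed.

Lemma DX_sqrt1 h (s : X -> R) : D h ->
  (forall x, val h x = (s x ^+ 2)%:C) -> (forall x, 0 <= s x <= 1) ->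
  exists2 g, D g & forall x, val g x = (s x)%:C.
Proof.
move=> Dh hs s01.
have sb : (fun x => (s x)%:C) \in @linfty_pred R X.
  apply/linfty_predP; exists 1 => x; have /andP[s0 s1] := s01 x.
  by rewrite /= expr0n addr0 sqrtr_sqr ger0_norm.
exists (mk_linfty sb) => //; apply: DX_closure => e e0.
pose n := Num.truncn (2 / e).
have [p pE pP] := sqrt_itP n hs s01.
exists (sqrt_it h n); first exact: sqrt_itD.
move=> x; have [/andP[p0 ps] dn] := pP x.
rewrite pE -rmorphB /= expr0n addr0 sqrtr_sqr ger0_norm ?subr_ge0//.
apply: le_lt_trans dn _; rewrite ltr_pdivrMr// mulrC -ltr_pdivrMr//.
apply: (@lt_trans _ _ n.+1%:R); last by rewrite ltr_nat.
by rewrite truncnS_gt.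
Qed.

Lemma DX_sqrt h (r : X -> R) : D h ->
  (forall x, val h x = (r x)%:C) -> (forall x, 0 <= r x) ->
  exists2 g, D g & forall x, val g x = (Num.sqrt (r x))%:C.
Proof.
move=> Dh hr r0; pose M := supnorm h + 1.
have M0 : 0 < M by rewrite ltr_wpDl ?supnorm_ge0.
have rM x : r x <= M.
  have := supnorm_ub h x; rewrite hr /= expr0n addr0 sqrtr_sqr ger0_norm//.
  by move=> rs; apply: le_trans rs _; rewrite lerDl.
have [|||g Dg gE] := @DX_sqrt1 ((M^-1)%:C *: h) (fun x => Num.sqrt (r x / M)).
- exact: DX_scale.
- move=> x; rewrite sqr_sqrtr ?divr_ge0 ?(ltW M0)//.
  by rewrite mulrC rmorphM /= -hr.
- move=> x; rewrite sqrtr_ge0 /= -[leRHS]sqrtr1 ler_wsqrtr//.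
  by rewrite ler_pdivrMr// mul1r.
exists ((Num.sqrt M)%:C *: g); first exact: DX_scale.
move=> x; rewrite -[LHS]/((Num.sqrt M)%:C * val g x) gE -rmorphM.
rewrite -sqrtrM ?(ltW M0)//; congr (Num.sqrt _)%:C.
by rewrite mulrCA divff ?mulr1// gt_eqF.
Qed.

End DXmembers.

Definition is_transfer (R : realType) (A : cstarType R) (al L : A -> A) : Prop :=
  [/\ linear L, continuous L, forall x, cstar_pos x -> cstar_pos (L x) &
      forall x y, L (al x ** y) = x ** L y].

Lemma contractive_continuous (R : realType) (A : cstarType R) (L : A -> A) :
  linear L -> (forall x, `|L x| <= `|x|) -> continuous L.
Proof.
move=> Ll Lc f; apply/cvgrPdist_lt => e e0; near=> g.
have -> : L f - L g = L (f - g).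
  by have := Ll (-1) g f; rewrite !scaleN1r [- g + f]addrC [- L g + _]addrC => ->.
apply: le_lt_trans (Lc _) _.
by near: g; exact: (@cvgr_dist_lt _ _ _ _ _ id f cvg_id).
Unshelve. all: by end_near. Qed.

(* (A, al, L) as in the definition of the crossed product: A unital, al a
   *-endomorphism, not necessarily unital, and L a transfer operator for al. *)
Record exel_system (R : realType) := ExelSystem {
  exel_alg :> cstarType R ;
  exel_endo : exel_alg -> exel_alg ;
  exel_transfer : exel_alg -> exel_alg ;
  exel_unital : exists e : exel_alg, is_cunit e ;
  exel_endoP : star_hom exel_endo ;
  exel_transferP : is_transfer exel_endo exel_transfer
}.

Section DXsystem.
Context {R : realType} {a : finType} (X : shift_space a).
Local Notation normc := (@Normc.normc R).
Local Notation B := (linfty R X).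
Local Notation D := (DX_set R X).

Lemma DXP (f g : DX R X) : (forall x, val (val f) x = val (val g) x) -> f = g.
Proof. by move=> fg; apply: val_inj; apply: linftyP. Qed.

Local Notation ev f x := (val (val (f : DX R X)) x).

Lemma ev_lin (k : R[i]) (f g : DX R X) x : ev (k *: f + g) x = k * ev f x + ev g x.
Proof. by rewrite csub_linE linfty_linE. Qed.
Lemma ev_mul (f g : DX R X) x : ev (f ** g) x = ev f x * ev g x.
Proof. by rewrite csub_mulE linfty_mulE. Qed.
Lemma ev_star (f : DX R X) x : ev (star f) x = (ev f x)^*.
Proof. by rewrite csub_starE linfty_starE. Qed.
Lemma ev_alpha (f : DX R X) x : ev (alphaX f) x = ev f (shift_on x).
Proof. by []. Qed.
Lemma ev_transfer (f : DX R X) x : ev (transferX f) x =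
  (#|` fset_set (fiber x)|%:R)^-1 * \sum_(y <- fset_set (fiber x)) ev f y.
Proof. by rewrite -transfer_funE. Qed.

Lemma DX_unital : exists e : DX R X, is_cunit e.
Proof.
exists (mkDX (@DX_one R a X)) => f; split; apply: DXP => x; rewrite ev_mul.
  exact: mul1r.
exact: mulr1.
Qed.

Lemma alphaX_star_hom : star_hom (@alphaX R a X).
Proof.
split => [k f g|f g|f]; apply: DXP => x.
- by rewrite ev_lin !ev_alpha ev_lin.
- by rewrite ev_mul !ev_alpha ev_mul.
- by rewrite ev_star !ev_alpha ev_star.
Qed.

Lemma transferX_linear : linear (@transferX R a X).
Proof.
move=> k f g; apply: DXP => x; rewrite ev_lin !ev_transfer.
under eq_bigr do rewrite ev_lin.
by rewrite big_split /= mulrDr -mulr_sumr mulrCA.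
Qed.

Lemma transferX_continuous : continuous (@transferX R a X).
Proof.
apply: contractive_continuous; first exact: transferX_linear.
move=> f; rewrite !csub_normE !linfty_normE lecR.
apply: supnorm_le; [exact: supnorm_ge0|exact: transfer_fun_le].
Qed.

Lemma transferX_positive (f : DX R X) : cstar_pos f -> cstar_pos (transferX f).
Proof.
move=> [b ->]; set h := transferX _.
have h0 x : 0 <= val (val h) x.
  rewrite ev_transfer.
  rewrite mulr_ge0 ?invr_ge0 ?ler0n//; apply: sumr_ge0 => y _.
  by rewrite ev_mul ev_star mulrC -sqr_normc exprn_ge0.
pose r x := complex.Re (val (val h) x).
have hr x : val (val h) x = (r x)%:C.
  by rewrite /r; case: (val _ x) (h0 x) => p q; rewrite lecE /= => /andP[/eqP ->].
have r0 x : 0 <= r x by rewrite -lecR -hr.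
have [g Dg gE] := DX_sqrt (DXvalP h) hr r0.
exists (mkDX Dg); apply: DXP => x; rewrite hr ev_mul ev_star.
have -> : ev (mkDX Dg) x = val g x by [].
rewrite gE.
have -> : ((Num.sqrt (r x))%:C)^* = (Num.sqrt (r x))%:C :> R[i] by simpc.
by rewrite -rmorphM -expr2 sqr_sqrtr.
Qed.

Lemma transferX_alpha (f g : DX R X) :
  transferX (alphaX f ** g) = f ** transferX g.
Proof.
apply: DXP => x; rewrite ev_mul !ev_transfer mulrCA; congr (_ * _).
rewrite mulr_sumr; apply: eq_big_seq => y.
rewrite in_fset_set; last exact: fiber_finite.
by rewrite ev_mul ev_alpha => /set_mem ->.
Qed.

Lemma transferXP : is_transfer (@alphaX R a X) (@transferX R a X).
Proof.
split; [exact: transferX_linear|exact: transferX_continuous|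
  exact: transferX_positive|exact: transferX_alpha].
Qed.

Definition DX_system : exel_system R :=
  ExelSystem DX_unital alphaX_star_hom transferXP.

Lemma indX_funP (Y : set X) : (fun z => (z \in Y)%:R) \in @linfty_pred R X.
Proof.
apply/linfty_predP; exists 1 => z.
by case: (z \in Y); rewrite ?Normc.normc1 ?Normc.normc0.
Qed.

Definition indX (Y : set X) : B := mk_linfty (indX_funP Y).

Lemma indX_letter (c : a) :
  D (indX [set z : X | val z 0%N = c]).
Proof.
apply: DX_cont.
have cont0 : continuous (fun z : X => (val z 0%N : discrete_topology a)).
  have H1 : continuous (set_val : X -> onesided a) by exact: initial_continuous.
  have H2 : continuous (fun w : onesided a => (w 0%N : discrete_topology a)).
    by move=> w; exact: (@proj_continuous _ (fun=> discrete_topology a) 0%N w).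
  by move=> z; exact: (continuous_comp (H1 z) (H2 _)).
move=> z; pose h := fun b : discrete_topology a => (b == c)%:R : R[i]^o.
have -> : (val (indX [set z : X | val z 0%N = c]) : X -> R[i]^o) =
    h \o (fun z : X => (val z 0%N : discrete_topology a)).
  apply/funext => y; rewrite /h /=; congr (nat_of_bool _)%:R.
  by apply/idP/eqP; rewrite inE.
apply: continuous_comp; first exact: cont0.
move=> U hU; apply: filterS (discrete_set1 _) => b ->.
exact: nbhs_singleton hU.
Qed.

Lemma wcat_rcons (u : seq a) c x : wcat (rcons u c) x = wcat u (scons c x).
Proof. by rewrite /wcat foldr_rcons. Qed.

Lemma wcat_shift (u : seq a) (x : onesided a) :
  shift_set X (wcat u x) -> shift_set X x.
Proof.
elim: u => [//|c u IH] /= Xu; apply: IH.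
by apply: shift_sub; exists (scons c (wcat u x)).
Qed.

(* 1 - \prod_(1 <= k <= n) (1 - k f) turns a function with values in {0} U {1/k}
   into the indicator of its support *)
Fixpoint supp_it (f : B) n : B := if n is m.+1
  then supp_it f m ** (- (m.+1%:R) *: f + onelinf X) else onelinf X.

Lemma supp_itD (f : B) n : D f -> D (supp_it f n).
Proof.
move=> Df; elim: n => [|n IH] /=; first exact: DX_one.
by apply: DX_mul => //; apply: DX_add; [exact: DX_scale|exact: DX_one].
Qed.

Lemma supp_itS (f : B) n z :
  val (supp_it f n.+1) z = val (supp_it f n) z * (1 - n.+1%:R * val f z).
Proof.
rewrite -[LHS]/(val (supp_it f n ** (- (n.+1%:R) *: f + onelinf X)) z).
by rewrite linfty_mulE linfty_linE mulNr addrC.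
Qed.

Lemma supp_it0 (f : B) n z : val f z = 0 -> val (supp_it f n) z = 1.
Proof.
by move=> f0; elim: n => [//|n IH]; rewrite supp_itS IH f0 mulr0 subr0 mul1r.
Qed.

Lemma supp_itV (f : B) n k z : (0 < k <= n)%N -> val f z = k%:R^-1 ->
  val (supp_it f n) z = 0.
Proof.
move=> /andP[k0 kn] fk; elim: n kn => [|n IH]; first by rewrite leqNgt k0.
rewrite leq_eqVlt supp_itS => /predU1P[kn|/IH -> ]; last by rewrite mul0r.
by rewrite fk -kn divff ?subrr ?mulr0// pnatr_eq0 -lt0n.
Qed.

Lemma cyl0P (u : seq a) (z : X) :
  (z \in cyl u [::]) = (wcat u (val z) \in shift_set X).
Proof.
apply/idP/idP; rewrite !inE; first by case=> x [-> ].
by exists (val z).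
Qed.

Lemma DX_cyl0 (u : seq a) : D (indX (cyl u [::])).
Proof.
elim/last_ind: u => [|u c IH].
  have -> : indX (cyl [::] [::]) = onelinf X :> B; last exact: DX_one.
  apply: linftyP => z; rewrite -[LHS]/((z \in cyl [::] [::])%:R) cyl0P.
  by rewrite -[wcat _ _]/(val z) (valP z).
pose f := transfer_linfty (indX [set z : X | val z 0%N = c] ** indX (cyl u [::])).
have Df : D f by apply: DX_transfer; apply: DX_mul => //; exact: indX_letter.
have fE z : val f z = (#|` fset_set (fiber z)|%:R)^-1 *
    \sum_(y <- fset_set (fiber z))
      ((val y 0%N == c) && (wcat u (val y) \in shift_set X))%:R.
  rewrite -[LHS]/(transfer_fun _ z) transfer_funE; congr (_ * _).
  apply: eq_bigr => y _; rewrite linfty_mulE.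
  rewrite -[LHS]/((y \in [set z : X | val z 0%N = c])%:R *
    (y \in cyl u [::])%:R) cyl0P -natrM mulnb; congr (nat_of_bool (_ && _))%:R.
  by apply/idP/eqP; rewrite inE.
have -> : indX (cyl (rcons u c) [::]) = (-1) *: supp_it f #|a| + onelinf X.
  apply: linftyP => z; rewrite linfty_linE mulN1r addrC.
  rewrite -[LHS]/((z \in cyl (rcons u c) [::])%:R) cyl0P wcat_rcons.
  rewrite -[val (onelinf X) z]/(1 : R[i]).
  have [zu|zu] := boolP (wcat u (scons c (val z)) \in shift_set X).
    have Xy : scons c (val z) \in shift_set X.
      by apply/mem_set; apply: (@wcat_shift u); exact: set_mem.
    pose y : X := exist (fun w => w \in shift_set X) _ Xy.
    have yz : fiber z y by apply: val_inj.
    have yf : y \in fset_set (fiber z).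
      by rewrite in_fset_set ?inE//; exact: fiber_finite.
    rewrite (@supp_itV f _ #|` fset_set (fiber z)|) ?subr0//.
      rewrite fiber_card andbT cardfs_gt0; apply/fset0Pn; by exists y.
    rewrite fE (bigD1_seq y) ?fset_uniq//= eqxx zu big1_seq ?addr0 ?mulr1//.
    move=> w /andP[wy wz]; case: eqP => //= w0; exfalso.
    move: wz; rewrite in_fset_set; last exact: fiber_finite.
    rewrite inE => wz; move/eqP: wy; apply; apply: (@fiber_inj _ _ z).
    - exact: mem_set.
    - exact: mem_set.
    - exact: w0.
  rewrite supp_it0 ?subrr// fE big1_seq ?mulr0// => y /andP[_].
  rewrite in_fset_set; last exact: fiber_finite.
  rewrite inE => yz; case: eqP => //= y0.
  have yE : val y = scons c (val z).
    apply/funext; case=> [|i]; first exact: y0.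
    by rewrite -[RHS]/(val z i) -yz.
  by rewrite yE (negbTE zu).
apply: DX_add; [apply: DX_scale; exact: supp_itD|exact: DX_one].
Qed.

Lemma DX_cyl (u v : seq a) : D (indX (cyl u v)).
Proof.
elim: v => [|c v IH]; first exact: DX_cyl0.
have -> : indX (cyl u (c :: v)) =
    indX [set z : X | val z 0%N = c] ** endo_linfty (indX (cyl u v)).
  apply: linftyP => z.
  rewrite -[RHS]/((z \in [set z : X | val z 0%N = c])%:R *
    (shift_on z \in cyl u v)%:R) -natrM mulnb; congr (nat_of_bool _)%:R.
  apply/idP/andP; rewrite !inE => -[].
    move=> x [zE ux]; split; first exact: (congr1 (fun w => w 0%N) zE).
    by exists x; split=> //; apply/funext => i; exact: (congr1 (fun w => w i.+1) zE).
  move=> z0 [x [zE ux]]; exists x; split => //; apply/funext; case=> [|i]; first exact: z0.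
  exact: (congr1 (fun w => w i) zE).
by apply: DX_mul; [exact: indX_letter|exact: DX_endo].
Qed.

Definition indC (u v : seq a) : DX R X := mkDX (DX_cyl u v).

End DXsystem.
Arguments DX_system R {a} X.
Arguments indC R {a} X u v.

Section CrossedProduct.
Context {R : realType} (A : exel_system R).
Local Notation al := (exel_endo (e := A)).
Local Notation L := (exel_transfer (e := A)).
Implicit Types T B Q : cstarType R.

Definition exel_covariant T (i : A -> T) (S : T) : Prop :=
  [/\ star_hom i,
      forall e, is_cunit e -> is_cunit (i e),
      forall x, S ** i x = i (al x) ** S &
      forall x, star S ** i x ** S = i (L x)].

(* (T, i, S) has the universal property defining T(A, al, L). All algebras and
   maps from A in it are unital; the injectivity of i is a consequence of the
   property and is not required. *)
Definition is_toeplitz T (i : A -> T) (S : T) : Prop :=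
  [/\ exel_covariant i S,
      cstar_gen (range i `|` [set S]) = setT &
      forall B (j : A -> B) (s : B), exel_covariant j s ->
        exists phi : T -> B,
          [/\ star_hom phi, forall x, phi (i x) = j x & phi S = s]].

Definition redundancy T (i : A -> T) (S : T) (x : A) (k : T) : Prop :=
  closed_span [set t | exists b c, t = i b ** S ** star S ** i c] k /\
  forall b, i x ** i b ** S = k ** i b ** S.

Definition redundancy_ideal T (i : A -> T) (S : T) : set T :=
  smallest (@closed_ideal R T)
    [set t | exists x k,
      [/\ closed_span [set y | exists b c d, y = b ** al c ** d] x,
          redundancy i S x k & t = i x - k]].

(* p identifies Q with T / J: a surjective *-homomorphism with kernel J induces
   an isometric isomorphism from the quotient C*-algebra T / J onto Q. *)
Definition is_quotient T Q (J : set T) (p : T -> Q) : Prop :=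
  [/\ star_hom p, range p = setT & forall t, p t = 0 <-> J t].

Definition is_crossed_product Q : Prop :=
  exists (T : cstarType R) (i : A -> T) (S : T) (p : T -> Q),
    is_toeplitz i S /\ is_quotient (redundancy_ideal i S) p.

End CrossedProduct.

Section Universal.
Context {R : realType} {a : finType} (X : shift_space a).

Definition shift_rep (B : cstarType R) (s : seq a -> B) : Prop :=
  [/\ forall u, partial_isometry (s u),
      forall u v, s u ** s v = s (u ++ v) &
      exists phi : DX R X -> B,
        [/\ star_hom phi,
            range phi `<=` cstar_gen (range s) &
            forall u v, phi (indC R X u v) =
              s v ** star (s u) ** s u ** star (s v)]].

Definition is_universal_shift_rep (Q : cstarType R) (S : seq a -> Q) : Prop :=
  [/\ shift_rep S,
      cstar_gen (range S) = setT &
      forall (B : cstarType R) (s : seq a -> B),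
        shift_rep s -> cstar_gen (range s) = setT ->
        exists phi : Q -> B, star_hom phi /\ forall u, phi (S u) = s u].

End Universal.

(* Main.v *)
Require Import Defs.
From HB Require Import structures.
From mathcomp Require Import all_boot all_order all_algebra finmap.
From mathcomp Require Import all_classical reals topology normedtype sequences.
From mathcomp Require Import complex interval_inference qpoly.

Set Implicit Arguments.
Unset Strict Implicit.
Unset Printing Implicit Defensive.
Import Order.TTheory GRing.Theory Num.Theory numFieldNormedType.Exports.
Local Open Scope classical_set_scope.
Local Open Scope ring_scope.
Local Open Scope complex_scope.

(* Let j : D_X -> Q be the canonical map, S the generator of the crossed product
   and m(x) = #sigma^-1(sigma x), a function in D_X. The letters act by
   S_c = j(m^(1/2) 1_C(eps,c)) S, so that S = j(m^(-1/2)) sum_c S_c. The transfer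
   relation gives S_c^* j(f) S_c = j(f(c .)), and a redundancy gives
   S_c j(f) S_c^* = j(1_C(eps,c) alpha(f)); (1) and (2) follow by induction on
   words. Conversely, for a family s with representation phi, the element
   phi(m^(-1/2)) sum_c s_c is covariant with phi, and the induced map on the
   Toeplitz algebra kills the redundancies because sum_c s_c s_c^* = 1.
   D_X is generated by the 1_C(u,v) because L is the average, over a number of
   preimages taking finitely many values, of the multiplicative maps f |-> f(c .). *)

(** * Elementary C*-algebra theory *)

(** Additive core of h^2 + (e - z)^2 = e when 2z = h^2 + z^2 and e is a unit; here [h] and [w] stand
    for the two squares. *)
Lemma addr_sqr_compl (V : zmodType) (e h z w : V) :
  z + z = h + w -> h + (e - z - (z - w)) = e.
Proof.
move=> zz; rewrite opprB addrACA -opprD zz opprD addrACA subrr addr0.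
by rewrite addrCA subrr addr0.
Qed.

Section CStarBasics.
Context {R : realType} {A : cstarType R}.
Implicit Types (a b c e g h : A) (k : R[i]).

Lemma cmulr0 a : a ** 0 = 0.
Proof. by apply: (@addrI _ (a ** 0)); rewrite -cmulDr !addr0. Qed.

Lemma cmul0r a : 0 ** a = 0.
Proof. by apply: (@addrI _ (0 ** a)); rewrite -cmulDl !addr0. Qed.

Lemma cmulrN a b : a ** - b = - (a ** b).
Proof. by rewrite -scaleN1r cmulZr scaleN1r. Qed.

Lemma cmulNr a b : (- a) ** b = - (a ** b).
Proof. by rewrite -scaleN1r cmulZl scaleN1r. Qed.

Lemma cmulrB a b c : a ** (b - c) = a ** b - a ** c.
Proof. by rewrite cmulDr cmulrN. Qed.

Lemma cmulBr a b c : (b - c) ** a = b ** a - c ** a.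
Proof. by rewrite cmulDl cmulNr. Qed.

Lemma cmul_sumr (I : Type) (r : seq I) (P : pred I) (F : I -> A) a :
  a ** (\sum_(i <- r | P i) F i) = \sum_(i <- r | P i) a ** F i.
Proof. by apply: (big_morph _ (cmulDr a)); exact: cmulr0. Qed.

Lemma cmul_suml (I : Type) (r : seq I) (P : pred I) (F : I -> A) a :
  (\sum_(i <- r | P i) F i) ** a = \sum_(i <- r | P i) F i ** a.
Proof.
by apply: (big_morph (fun b => b ** a)) => [b c|]; [exact: cmulDl|exact: cmul0r].
Qed.

Lemma star0 : star (0 : A) = 0.
Proof. by apply: (@addrI _ (star (0 : A))); rewrite -starD !addr0. Qed.

Lemma starN a : star (- a) = - star a.
Proof. by apply: (@addrI _ (star a)); rewrite -starD !subrr star0. Qed.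

Lemma starB a b : star (a - b) = star a - star b.
Proof. by rewrite starD starN. Qed.

Lemma star_sum (I : Type) (r : seq I) (P : pred I) (F : I -> A) :
  star (\sum_(i <- r | P i) F i) = \sum_(i <- r | P i) star (F i).
Proof. by apply: (big_morph _ (@starD R A)); exact: star0. Qed.

Lemma norm_star a : `|star a| = `|a|.
Proof.
suff le_star b : `|b| <= `|star b|.
  by apply/eqP; rewrite eq_le le_star andbT -{2}[a]starK le_star.
have [->|b0] := eqVneq b 0; first by rewrite star0.
rewrite -(@ler_pM2r _ `|b|) ?normr_gt0//.
by rewrite -expr2 -cstar_id cnormM.
Qed.

Lemma star_mul_eq0 a : star a ** a = 0 -> a = 0.
Proof.
move=> aa0; apply/normr0_eq0/eqP; rewrite -sqrf_eq0 -cstar_id aa0.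
by rewrite normr0.
Qed.

Lemma cunit_uniq e g : is_cunit e -> is_cunit g -> e = g.
Proof. by move=> eU gU; rewrite -[RHS](eU g).1 (gU e).2. Qed.

Lemma cunit_star e : is_cunit e -> star e = e.
Proof.
move=> eU; have ee : star e = e ** star e by rewrite (eU _).1.
by rewrite -[RHS]starK {2}ee starM starK -ee.
Qed.

Lemma proj_norm_le1 a : star a ** a = a -> `|a| <= 1.
Proof.
move=> aa; have [->|a0] := eqVneq a 0; first by rewrite normr0.
by rewrite -(@ler_pM2r _ `|a|) ?normr_gt0// mul1r -expr2 -cstar_id aa.
Qed.

(** By the C*-identity it suffices that d = a p - a satisfies d^* d = 0, and all four terms of the
    expansion are p up to sign. *)
Lemma proj_partial_isometry a p :
  star a ** a = p -> p ** p = p -> partial_isometry a.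
Proof.
move=> aap pp; apply/eqP; rewrite -subr_eq0; apply/eqP/star_mul_eq0.
have ps : star p = p by rewrite -aap starM starK.
rewrite -cmulA aap starB starM ps cmulrB !cmulBr.
by rewrite !cmulA -[p ** _ ** a]cmulA aap !pp !subrr.
Qed.

(** With q = a^* a, the four products in (a - q)^* (a - q) are all q up to sign, so a equals the
    projection q. This makes the element of the empty word self-adjoint. *)
Lemma idem_partial_isometry_star a :
  a ** a = a -> partial_isometry a -> star a = a.
Proof.
move=> aa pia; set q := star a ** a.
have qs : star q = q by rewrite /q starM starK.
have aq : a ** q = a by rewrite cmulA.
have qa : q ** a = q by rewrite -cmulA aa.
have saq : star a ** q = q by rewrite cmulA -starM aa.
have qq : q ** q = q by rewrite {1}/q -cmulA aq.
suff -> : a = q by [].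
apply/eqP; rewrite -subr_eq0; apply/eqP/star_mul_eq0.
by rewrite starB qs cmulrB !cmulBr -/q saq qa qq !subrr.
Qed.

Lemma additive_bound_continuous {B : cstarType R} (f : A -> B) (M : R[i]) :
  0 < M -> {morph f : a b / a - b} -> (forall a, `|f a| <= M * `|a|) ->
  continuous f.
Proof.
move=> M0 fB fM a; apply/cvgrPdist_lt => e e0; near=> b.
rewrite -fB; apply: le_lt_trans (fM _) _; rewrite -ltr_pdivlMl//.
near: b; apply: (@cvgr_dist_lt _ _ _ _ _ id a cvg_id).
by rewrite mulr_gt0 ?invr_gt0.
Unshelve. all: by end_near. Qed.

Lemma cmul_continuousl a : continuous (cmul a).
Proof.
apply: (@additive_bound_continuous A _ (`|a| + 1)) => [|b c|b].
- by rewrite ltr_wpDl.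
- exact: cmulrB.
- by apply: le_trans (cnormM _ _) _; rewrite ler_wpM2r// lerDl.
Qed.

Lemma cmul_continuousr a : continuous (fun b => b ** a).
Proof.
apply: (@additive_bound_continuous A _ (`|a| + 1)) => [|b c|b].
- by rewrite ltr_wpDl.
- exact: cmulBr.
- by apply: le_trans (cnormM _ _) _; rewrite mulrC ler_wpM2r// lerDl.
Qed.

Lemma star_continuous : continuous (@star R A).
Proof.
apply: (@additive_bound_continuous A _ 1) => // [b c|b]; first exact: starB.
by rewrite mul1r norm_star.
Qed.

Lemma closed_eqfun {B : cstarType R} (f g : A -> B) :
  continuous f -> continuous g -> closed [set a | f a = g a].
Proof.
move=> cf cg a cla; apply/eqP; rewrite -subr_eq0 -normr_le0.
apply/negP => fga; have d0 : 0 < `|f a - g a|.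
  by rewrite lt_def normr_ge0 andbT; apply/eqP => fga0; apply: fga; rewrite fga0.
have d2 : 0 < `|f a - g a| / 2 by rewrite divr_gt0.
have [b [/= fgb [ab1 ab2]]] := cla _ (filterI
  (@cvgr_dist_lt _ _ _ _ _ f _ (cf a) _ d2)
  (@cvgr_dist_lt _ _ _ _ _ g _ (cg a) _ d2)).
have : `|f a - g a| < `|f a - g a|.
  rewrite [ltRHS]splitr -[in ltLHS](subrK (f b) (f a)) -addrA {2}fgb.
  apply: le_lt_trans (ler_normD _ _) _; apply: ltrD; first exact: ab1.
  by rewrite distrC; exact: ab2.
by rewrite ltxx.
Qed.

Lemma cstar_gen_subalg (G : set A) : cstar_subalg (cstar_gen G).
Proof. by apply: cstar_subalg_bigcap => S []. Qed.

Lemma cstar_gen_sub (G S : set A) :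
  cstar_subalg S -> G `<=` S -> cstar_gen G `<=` S.
Proof. by move=> Ssub GS a; apply. Qed.

Lemma sub_cstar_gen (G : set A) : G `<=` cstar_gen G.
Proof. by move=> a Ga S [_]; apply. Qed.

Lemma cstar_subalg_sum (S : set A) (I : Type) (r : seq I) (P : pred I)
  (F : I -> A) : cstar_subalg S -> (forall i, P i -> S (F i)) ->
  S (\sum_(i <- r | P i) F i).
Proof.
by move=> [_ [S0 SD] _ _ _] SF; elim/big_ind: _.
Qed.

(** Passes the unit property from generators to the C*-algebra they generate; used in [rep_unit]. *)
Lemma cunit_subalg e : star e = e ->
  cstar_subalg [set a | e ** a = a /\ a ** e = a].
Proof.
move=> es; split.
- apply: (@closedI _ [set a | e ** a = a] [set a | a ** e = a]).
    apply: closed_eqfun; first exact: cmul_continuousl.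
    by move=> x; exact: cvg_id.
  apply: closed_eqfun; first exact: cmul_continuousr.
  by move=> x; exact: cvg_id.
- split; first by rewrite /= cmulr0 cmul0r.
  by move=> a b /= [ea ae] [eb be]; rewrite cmulDr cmulDl ea ae eb be.
- by move=> k a /= [ea ae]; rewrite cmulZr cmulZl ea ae.
- by move=> a b /= [ea ae] [eb be]; rewrite cmulA ea -cmulA be.
- by move=> a /= [ea ae]; split; rewrite -{1}es -starM ?ea ?ae.
Qed.

(** The solution is z = 1 - (1 - h^2)^(1/2), found without a unit: on the ball of radius 1/2 the map
    [F] is a contraction with factor 1/2, and its iterates from 0 are real polynomials in h, hence
    self-adjoint and commuting with h. *)
Lemma commute_half_sqr_fixpoint h : star h = h -> `|h| <= 2^-1 ->
  exists z, [/\ star z = z, h ** z = z ** h & z + z = h ** h + z ** z].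
Proof.
move=> hs h2; pose F z := 2^-1 *: (h ** h + z ** z).
pose y n := iter n F 0.
have h4 : `|h ** h| <= 2^-1 * 2^-1.
  by apply: le_trans (cnormM _ _) _; rewrite ler_pM.
have n2 : `|2^-1 : R[i]| = 2^-1 by rewrite ger0_norm// invr_ge0 ler0n.
have half : (2^-1 + 2^-1 : R[i]) = 1 by rewrite [RHS]splitr div1r.
have cj : (2^-1 : R[i])^* = 2^-1 by rewrite fmorphV rmorph_nat.
have half0 : 0 < 2^-1 :> R[i] by rewrite invr_gt0 ltr0n.
have half1 : 2^-1 <= 1 :> R[i] by rewrite invf_le1 ?ltr0n// ler1n.
have y2 n : `|y n| <= 2^-1.
  elim: n => [|n IH]; first by rewrite normr0 ltW.
  rewrite [y _]iterS -/(y n) /F normrZ n2 -[leRHS]mulr1 ler_wpM2l ?(ltW half0)//.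
  apply: le_trans (ler_normD _ _) _; rewrite -half; apply: lerD.
    by apply: le_trans h4 _; rewrite -[leRHS]mulr1 ler_wpM2l// ltW.
  apply: le_trans (cnormM _ _) _; apply: (@le_trans _ _ (2^-1 * 2^-1)).
    by rewrite ler_pM.
  by rewrite -[leRHS]mulr1 ler_wpM2l// ltW.
(* Without commutativity, z^2 - w^2 = z (z - w) + (z - w) w; the radius 1/2 and the factor 1/2 in
   [F] give the Lipschitz constant 1/2. *)
have Fd z w : `|z| <= 2^-1 -> `|w| <= 2^-1 -> `|F z - F w| <= 2^-1 * `|z - w|.
  move=> z2 w2; rewrite -scalerBr normrZ n2 ler_wpM2l ?(ltW half0)//.
  have -> : h ** h + z ** z - (h ** h + w ** w) = z ** (z - w) + (z - w) ** w.
    by rewrite cmulrB cmulBr addrA subrK opprD addrACA subrr add0r.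
  apply: le_trans (ler_normD _ _) _.
  rewrite -[leRHS]mul1r -half mulrDl; apply: lerD.
    by apply: le_trans (cnormM _ _) _; rewrite ler_wpM2r.
  by apply: le_trans (cnormM _ _) _; rewrite mulrC ler_wpM2r.
have yd n m : `|y (n + m)%N - y n| <= 2^-1 ^+ n.
  elim: n => [|n IH].
    by rewrite add0n subr0 expr0; apply: le_trans (y2 _) _.
  rewrite addSn [y n.+1]iterS [y _]iterS -/(y n) -/(y (n + m)%N).
  by apply: le_trans (Fd _ _ _ _) _ => //; rewrite exprS ler_wpM2l// ltW.
have small (e : R[i]) : 0 < e -> exists N, 2^-1 ^+ N < e.
  case: e => e e'; rewrite ltcE /= => /andP[/eqP -> e0].
  have [N _ /(_ N (leqnn N)) NP] := near_infty_natSinv_expn_lt (PosNum e0).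
  exists N; move: NP; rewrite /= -/(e%:C) div1r -ltcR.
  by rewrite fmorphV rmorphXn /= rmorph_nat exprVn.
have ymono N n : (N <= n)%N -> `|y N - y n| <= 2^-1 ^+ N.
  by move=> Nn; rewrite distrC -(subnKC Nn).
have yc : cauchy (y @ \oo).
  apply/cauchy_ballP => e e0; have [N Ne] := small _ (divr_gt0 e0 (ltr0Sn _ 1)).
  have FN : (y @ \oo) [set z | `|y N - z| < e / 2].
    by exists N => // n /= Nn; apply: le_lt_trans (ymono _ _ _) _.
  exists ([set z | `|y N - z| < e / 2], [set z | `|y N - z| < e / 2]) => //.
  move=> [z w] /= [zN wN]; rewrite -ball_normE /=.
  rewrite -(subrK (y N) z) -addrA; apply: le_lt_trans (ler_normD _ _) _.
  by rewrite [ltRHS]splitr distrC ltrD.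
have /cauchy_cvg/cvg_ex[z yz] := yc.
have Scl (S : set A) : closed S -> (forall n, S (y n)) -> S z.
  by move=> cS Sy; apply: (@closed_cvg _ _ \oo _ y S cS _ z yz); exact: nearW.
have idc : continuous (@id A) by move=> ?; exact: cvg_id.
exists z; split.
- apply: (Scl [set x | star x = x]).
    by apply: closed_eqfun => //; exact: star_continuous.
  elim=> [|n /= IH]; first exact: star0.
  rewrite -/(y n) starZ starD !starM hs IH; congr (_ *: _).
  exact: cj.
- apply: (Scl [set x | h ** x = x ** h]).
    by apply: closed_eqfun; [exact: cmul_continuousl|exact: cmul_continuousr].
  elim=> [|n /= IH]; first by rewrite /= cmulr0 cmul0r.
  rewrite -/(y n) cmulZr cmulZl cmulDr cmulDl; congr (_ *: (_ + _)).
    by rewrite cmulA.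
  by rewrite cmulA IH -cmulA IH cmulA.
- have near_z (e : R[i]) : 0 < e -> exists n, `|z - y n| < e /\ `|z - y n.+1| < e.
    move=> e0; have [N _ NP] := @cvgr_dist_lt _ _ _ _ _ _ _ yz _ e0.
    by exists N; split; apply: NP => /=.
  have z2 : `|z| <= 2^-1.
    rewrite real_leNgt ?normr_real ?gtr0_real//; apply/negP => z2.
    have [|n [yn _]] := near_z (`|z| - 2^-1); first by rewrite subr_gt0.
    suff : `|z| < `|z| by rewrite ltxx.
    rewrite -[in ltLHS](subrK (y n) z); apply: le_lt_trans (ler_normD _ _) _.
    by rewrite -[ltRHS](subrK 2^-1) ltr_leD.
  (* Both sides are compared with y_(n+1) = F y_n, which is close to z, while [F] is a
     contraction. *)
  have zF : z = F z.
    apply/eqP; rewrite -subr_eq0; apply: contraT; rewrite -normr_gt0 => d0.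
    have d2 : 0 < `|z - F z| / 2 by rewrite divr_gt0.
    have [n [yn yn1]] := near_z _ d2.
    suff : `|z - F z| < `|z - F z| by rewrite ltxx.
    apply: le_lt_trans (ler_distD (y n.+1) _ _) _; rewrite [ltRHS]splitr ltr_leD//.
    apply: le_trans (Fd _ _ (y2 n) z2) _; rewrite distrC.
    by apply: le_trans (ltW yn); rewrite -[leRHS]mul1r ler_wpM2r.
  have {1 2}-> : z = 2^-1 *: (h ** h + z ** z) by [].
  by rewrite -scalerDl half scale1r.
Qed.

End CStarBasics.

(** * Boundedness and continuity of *-homomorphisms *)

Section StarHom.
Context {R : realType} {A B : cstarType R} (f : A -> B).
Hypothesis fP : star_hom f.
Implicit Types (a e h : A).

Lemma star_homD : {morph f : a b / a + b}.
Proof.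
by case: fP => fl _ _ a b; have := fl 1 a b; rewrite !scale1r.
Qed.

Lemma star_hom0 : f 0 = 0.
Proof. by apply: (@addrI _ (f 0)); rewrite -star_homD !addr0. Qed.

Lemma star_homZ (k : R[i]) a : f (k *: a) = k *: f a.
Proof.
by case: fP => fl _ _; have := fl k a 0; rewrite !addr0 star_hom0 addr0.
Qed.

Lemma star_homB : {morph f : a b / a - b}.
Proof. by move=> a b; rewrite star_homD -scaleN1r star_homZ scaleN1r. Qed.

Lemma star_homM : {morph f : a b / a ** b}.
Proof. by case: fP. Qed.

Lemma star_homS : {morph f : a / star a}.
Proof. by case: fP. Qed.

Lemma star_hom_sum (I : Type) (r : seq I) (P : pred I) (F : I -> A) :
  f (\sum_(i <- r | P i) F i) = \sum_(i <- r | P i) f (F i).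
Proof. by apply: (big_morph _ star_homD); exact: star_hom0. Qed.

(* With g = (1 - h^2)^(1/2), the element u = f h + i f g satisfies u^* u = f 1, so
   its real part f h has norm at most 1; this replaces spectral theory. *)
Lemma star_hom_selfadj_bound e h : is_cunit e -> star h = h ->
  `|h| <= 2^-1 -> `|f h| <= 1.
Proof.
move=> eU hs h2; have [z [zs hz zz]] := commute_half_sqr_fixpoint hs h2.
pose g := e - z; have es := cunit_star eU.
have gs : star g = g by rewrite starB es zs.
have gh : g ** h = h ** g by rewrite cmulBr cmulrB (eU h).1 (eU h).2 hz.
have ggh : h ** h + g ** g = e.
  rewrite /g cmulrB !cmulBr !(eU _).1 (eU z).2.
  exact: addr_sqr_compl.
have fgs : star (f g) = f g by rewrite -star_homS gs.
have fhs : star (f h) = f h by rewrite -star_homS hs.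
have fes : star (f e) = f e by rewrite -star_homS es.
have [i [ci ii]] : exists i : R[i], i^*%C = - i /\ i * i = -1.
  by exists (0 +i* 1); split; simpc.
pose u := f h + i *: f g.
have us : star u = f h - i *: f g.
  rewrite /u starD starZ fgs fhs -scaleNr; congr (_ + _ *: _); exact: ci.
have uu : star u ** u = f e.
  rewrite us /u cmulDr !cmulBr !cmulZl !cmulZr -!star_homM gh scalerA.
  rewrite addrA subrK ii scaleN1r opprK.
  by rewrite -star_homD ggh.
have fe1 : `|f e| <= 1.
  by apply: proj_norm_le1; rewrite fes -star_homM (eU e).1.
have u1 : `|u| <= 1.
  by rewrite -(@expr_le1 _ 2)// -cstar_id uu.
have half : (2^-1 + 2^-1 : R[i]) = 1 by rewrite [RHS]splitr div1r.
have -> : f h = 2^-1 *: (u + star u).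
  rewrite us addrACA subrr addr0 scalerDr -scalerDl half scale1r//.
rewrite normrZ ger0_norm ?invr_ge0 ?ler0n// -[leRHS](@mulVf _ 2) ?pnatr_eq0//.
rewrite ler_wpM2l ?invr_ge0 ?ler0n//; apply: le_trans (ler_normD _ _) _.
by rewrite norm_star lerD.
Qed.

(** A self-adjoint h is rescaled to norm 1/2 for [star_hom_selfadj_bound]; for general a, |f a|^2 =
    |f (a^* a)|. The constant 2 is crude but gives continuity. *)
Lemma star_hom_bound e a : is_cunit e -> `|f a| <= 2 * `|a|.
Proof.
move=> eU; have selfadj h : star h = h -> `|f h| <= 2 * `|h|.
  move=> hs; have [->|h0] := eqVneq h 0; first by rewrite star_hom0 !normr0 mulr0.
  have n0 : 0 < 2 * `|h| by rewrite mulr_gt0 ?normr_gt0.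
  have := @star_hom_selfadj_bound e ((2 * `|h|)^-1 *: h) eU.
  rewrite star_homZ !normrZ ger0_norm ?invr_ge0 ?(ltW n0)// !ler_pdivrMl// mulr1.
  apply.
    rewrite starZ hs; congr (_ *: _); apply/CrealP.
    by rewrite ger0_real// invr_ge0 ltW.
  by rewrite mulrAC mulfV ?mul1r ?pnatr_eq0.
rewrite -(@ler_pXn2r _ 2) ?nnegrE ?mulr_ge0//.
rewrite -cstar_id -star_homS -star_homM; apply: le_trans (selfadj _ _) _.
  by rewrite starM starK.
rewrite cstar_id exprMn ler_wpM2r ?exprn_ge0//.
by rewrite expr2 ler_pMr// ler1n.
Qed.

Lemma star_hom_continuous e : is_cunit e -> continuous f.
Proof.
move=> eU.
by apply: (additive_bound_continuous _ star_homB (fun a => star_hom_bound a eU)).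
Qed.

Lemma star_hom_preimage e (S : set B) : is_cunit e -> cstar_subalg S ->
  cstar_subalg (f @^-1` S).
Proof.
move=> eU [Scl [S0 SD] SZ SM SS]; split.
- by apply: preimage_closed => // x _; exact: star_hom_continuous eU x.
- by split; rewrite /= ?star_hom0// => a b /=; rewrite star_homD; exact: SD.
- by move=> k a /=; rewrite star_homZ; exact: SZ.
- by move=> a b /=; rewrite star_homM; exact: SM.
- by move=> a /=; rewrite star_homS; exact: SS.
Qed.

End StarHom.

(** * The cylinder functions generate D_X *)

Lemma cvg_initial {S : choiceType} {T : topologicalType} (f : S -> T)
    (F : set_system S) (s : initial_topology f) :
  Filter F -> f @ F --> f s -> F --> s.
Proof.
move=> FF fF U; rewrite nbhsE => -[B [[C oC <-] Cs] BU].
by apply: filterS BU _; apply: fF; apply: open_nbhs_nbhs.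
Qed.

Section Words.
Context {a : finType} (X : shift_space a).

Lemma cvg_agree (y : nat -> onesided a) (z : onesided a) :
  (forall n i, (i < n)%N -> y n i = z i) -> y @ \oo --> z.
Proof.
move=> yz; apply/cvg_sup => i; apply: cvg_initial => U /nbhs_singleton Uz.
by exists i.+1 => // n /= ni; rewrite /= yz.
Qed.

Lemma cvg_agreeX (y : nat -> X) (z : X) :
  (forall n i, (i < n)%N -> val (y n) i = val z i) -> y @ \oo --> z.
Proof. by move=> yz; apply: cvg_initial; exact: cvg_agree. Qed.

(** With u empty, the condition u x in X follows from w x in X by [wcat_shift], so only the prefix
    counts. *)
Lemma cyl_prefixP (w : seq a) (z : X) :
  (z \in cyl [::] w) = (mkseq (val z) (size w) == w).
Proof.
apply/idP/eqP; rewrite inE.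
  move=> [x [-> _]]; elim: w => [//|c w IH] /=.
  by rewrite /mkseq /= (iotaDl 1 0) -map_comp; congr (_ :: _).
move=> zw; pose x : onesided a := fun i => val z (size w + i)%N.
suff zx : val z = wcat w x.
  exists x; split=> //; apply: (@wcat_shift _ X w); rewrite -zx.
  exact: set_mem (valP z).
rewrite /x => {x}; move: (val z) zw; elim: w => [|c w IH] x.
  by move=> _; apply/funext.
rewrite /mkseq /= (iotaDl 1 0) -map_comp => -[xc xw].
apply/funext => -[|i] //=.
by have /(congr1 (fun t => t i)) := IH (fun j => x j.+1) xw.
Qed.

End Words.

(** * Inverse branches of the shift and the algebra of cylinder functions *)

Section Branch.
Context {R : realType} {a : finType} (X : shift_space a).
Local Notation normc := (@Normc.normc R).
Local Notation B := (linfty R X).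
Implicit Types (f g : B) (c : a) (x y z : X).

Lemma onelinfE x : val (onelinf X : B) x = 1.
Proof. by []. Qed.

Lemma linfty_unit : is_cunit (onelinf X : B).
Proof.
by move=> f; split; apply: linftyP => x; rewrite linfty_mulE ?mul1r ?mulr1.
Qed.

Definition branch_fun c (f : X -> R[i]) x : R[i] :=
  if pselect (shift_set X (scons c (val x))) is left cx
  then f (exist _ (scons c (val x)) (mem_set cx)) else 0.

Lemma branch_funP c f : branch_fun c (val f) \in @linfty_pred R X.
Proof.
apply/linfty_predP; exists (supnorm f) => x; rewrite /branch_fun.
by case: pselect => [cx|_]; [exact: supnorm_ub|rewrite Normc.normc0 supnorm_ge0].
Qed.

(* [branch c f] is x |-> f(cx), extended by 0 where cx is not in X; unlike the
   transfer operator it is multiplicative. *)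
Definition branch c f : B := mk_linfty (branch_funP c f).

Lemma branchE c f x y : val y = scons c (val x) -> val (branch c f) x = val f y.
Proof.
move=> yx; rewrite /= /branch_fun; case: pselect => [cx|].
  by congr (val f _); apply: val_inj.
by rewrite -yx => -[]; exact: set_mem (valP y).
Qed.

Lemma branch0 c f x : ~ shift_set X (scons c (val x)) -> val (branch c f) x = 0.
Proof. by move=> cx; rewrite /= /branch_fun; case: pselect. Qed.

Lemma branchP c x :
  (exists2 y, val y = scons c (val x) & forall f, val (branch c f) x = val f y) \/
  (~ shift_set X (scons c (val x)) /\ forall f, val (branch c f) x = 0).
Proof.
have [cx|cx] := pselect (shift_set X (scons c (val x))); [left|right].
  exists (exist _ (scons c (val x)) (mem_set cx)) => // f; exact: branchE.
by split=> // f; exact: branch0.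
Qed.

Lemma branch_star_hom c : star_hom (branch c).
Proof.
by split=> [k f g|f g|f]; apply: linftyP => x;
  rewrite ?(linfty_linE, linfty_mulE, linfty_starE);
  have [[y _ fy]|[_ fy]] := branchP c x;
  rewrite !fy ?(linfty_linE, linfty_mulE, linfty_starE) ?mulr0 ?addr0 ?conjc0.
Qed.

Lemma endo_star_hom : star_hom (@endo_linfty R a X).
Proof. by split=> [k f g|f g|f]; apply: linftyP. Qed.

Definition fibn x : nat := #|` fset_set (fiber x)|.

Lemma fibn_le x : (fibn x <= #|a|)%N.
Proof. exact: fiber_card. Qed.

Lemma scons_fiber c x y :
  val y = scons c (val x) <-> fiber x y /\ val y 0%N = c.
Proof.
split=> [yx|[/(congr1 val)/= yx y0]].
  by split; [apply: val_inj; rewrite /= yx|rewrite yx].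
by apply/funext => -[|i] //=; rewrite -yx.
Qed.

(** A preimage of x is determined by its first letter c and then equals cx, so the fibre splits into
    at most one point per letter. *)
Lemma fiber_sum f x :
  \sum_(y <- fset_set (fiber x)) val f y = \sum_c val (branch c f) x.
Proof.
have fibE y : (y \in fset_set (fiber x)) = (y \in fiber x).
  by rewrite in_fset_set//; exact: fiber_finite.
rewrite (partition_big (fun y => val y 0%N : a) xpredT)//.
apply: eq_bigr => c _; have [[y yx ->]|[cx ->]] := branchP c x.
  have [yf y0] := (scons_fiber c x y).1 yx.
  rewrite big_mkcond (bigD1_seq y) ?fset_uniq ?fibE ?inE//= y0 eqxx.
  rewrite big1_seq ?addr0// => z /andP[zy]; rewrite fibE inE => zf.
  case: eqP => // z0; case/eqP: zy; apply: val_inj.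
  by rewrite yx; apply/(scons_fiber c x z).
rewrite big_seq_cond big1// => y /andP[]; rewrite fibE inE => yf /eqP y0.
case: cx; rewrite -((scons_fiber c x y).2 (conj yf y0)).
exact: set_mem (valP y).
Qed.

Lemma fibnE x : (fibn x)%:R = \sum_c val (branch c (onelinf X)) x :> R[i].
Proof.
rewrite -fiber_sum (eq_bigr (fun=> 1)) => [|y _]; last by [].
by rewrite big_const_seq count_predT iter_addr addr0.
Qed.

(** Splits L into a weight depending only on the fibre size and a sum of multiplicative maps;
    [cyl_alg_transfer] rests on this form. *)
Lemma transferE f x :
  val (transfer_linfty f) x = (fibn x)%:R^-1 * \sum_c val (branch c f) x.
Proof. by rewrite -[LHS]/(transfer_fun _ x) transfer_funE fiber_sum. Qed.

Lemma fun_fibn_bounded (psi : nat -> R[i]) :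
  (fun x => psi (fibn x)) \in @linfty_pred R X.
Proof.
apply/linfty_predP; exists (\sum_(i < #|a|.+1) normc (psi i)) => x.
have nx : (fibn x < #|a|.+1)%N by rewrite ltnS fibn_le.
rewrite (bigD1 (Ordinal nx))//= lerDl; apply: sumr_ge0 => i _.
exact: normc_ge0.
Qed.

Definition fun_fibn psi : B := mk_linfty (fun_fibn_bounded psi).

Lemma indXE (Y : set X) x : val (indX (R := R) Y) x = (x \in Y)%:R.
Proof. by []. Qed.

Lemma branch_one c : branch c (onelinf X) = indX (cyl [:: c] [::]).
Proof.
apply: linftyP => x; rewrite indXE cyl0P.
have [[y yx ->]|[cx ->]] := branchP c x; last by rewrite memNset.
by rewrite mem_set//= -yx; exact: set_mem (valP y).
Qed.

Lemma linfty_sumE (I : Type) (r : seq I) (P : pred I) (F : I -> B) x :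
  val (\sum_(i <- r | P i) F i) x = \sum_(i <- r | P i) val (F i) x.
Proof. exact: (big_morph (fun f : B => val f x)). Qed.

Lemma cyl_cons c u v z :
  (z \in cyl u (c :: v)) = (val z 0%N == c) && (shift_on z \in cyl u v).
Proof.
apply/idP/andP; rewrite !inE => -[].
  by move=> x [zE ux]; split; [rewrite zE|exists x; split=> //=; rewrite zE].
move=> /eqP z0 [x [zE ux]]; exists x; split=> //.
by apply/funext => -[|i] //=; rewrite -zE.
Qed.

Lemma endo_cyl u v :
  endo_linfty (indX (cyl u v)) = \sum_c indX (cyl u (c :: v)) :> B.
Proof.
apply: linftyP => z; rewrite linfty_sumE (bigD1 (val z 0%N))//= cyl_cons eqxx.
by rewrite big1 ?addr0// => c; rewrite cyl_cons eq_sym => /negbTE ->.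
Qed.

(** If cx is not in X then neither is ucx, by shift invariance, so the default value 0 is the right
    one. *)
Lemma branch_cyl0 c u :
  branch c (indX (cyl u [::])) = indX (cyl (rcons u c) [::]).
Proof.
apply: linftyP => x; rewrite indXE cyl0P.
have [[y yx ->]|[cx ->]] := branchP c x.
  by rewrite indXE cyl0P wcat_rcons -yx.
rewrite wcat_rcons memNset//; apply: contra_not cx; exact: wcat_shift.
Qed.

(** The factor for C(c, eps) records that cx must lie in X. *)
Lemma branch_cyl c d u v : branch c (indX (cyl u (d :: v))) =
  if c == d then indX (cyl [:: c] [::]) ** indX (cyl u v) else 0.
Proof.
apply: linftyP => x; have [[y yx yE]|[cx xE]] := branchP c x.
  rewrite yE indXE cyl_cons yx eq_sym.
  have -> : shift_on y = x by apply: val_inj; rewrite /= yx.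
  case: (d == c) => //; rewrite linfty_mulE -branch_one yE.
  exact/esym/mul1r.
rewrite xE; case: (c == d) => //.
by rewrite linfty_mulE -branch_one xE mul0r.
Qed.

Definition cyl_alg : set B :=
  cstar_gen [set f | exists u v, f = indX (cyl u v)].

Lemma cyl_alg_subalg : cstar_subalg cyl_alg.
Proof. exact: cstar_gen_subalg. Qed.

Lemma cyl_alg_ind u v : cyl_alg (indX (cyl u v)).
Proof. by apply: sub_cstar_gen; exists u, v. Qed.

Lemma indX_cyl0 : indX (cyl [::] [::]) = onelinf X :> B.
Proof.
by apply: linftyP => x; rewrite indXE cyl0P mem_set//; exact: set_mem (valP x).
Qed.

Lemma cyl_alg_one : cyl_alg (onelinf X).
Proof. by rewrite -indX_cyl0; exact: cyl_alg_ind. Qed.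

Lemma cyl_alg_preimage (F : B -> B) : star_hom F ->
  (forall u v, cyl_alg (F (indX (cyl u v)))) ->
  forall f, cyl_alg f -> cyl_alg (F f).
Proof.
move=> Fh FE; apply: cstar_gen_sub; last by move=> _ [u [v ->]]; exact: FE.
exact: (star_hom_preimage Fh linfty_unit cyl_alg_subalg).
Qed.

Lemma cyl_alg_endo f : cyl_alg f -> cyl_alg (endo_linfty f).
Proof.
apply: cyl_alg_preimage; first exact: endo_star_hom.
move=> u v; rewrite endo_cyl; apply: cstar_subalg_sum; first exact: cyl_alg_subalg.
by move=> c _; exact: cyl_alg_ind.
Qed.

Lemma cyl_alg_branch c f : cyl_alg f -> cyl_alg (branch c f).
Proof.
apply: cyl_alg_preimage; first exact: branch_star_hom.
have [_ [E0 _] _ EM _] := cyl_alg_subalg.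
move=> u [|d v]; first by rewrite branch_cyl0; exact: cyl_alg_ind.
by rewrite branch_cyl; case: ifP => // _; apply: EM; exact: cyl_alg_ind.
Qed.

Lemma cyl_alg_poly g (p : {poly R[i]}) : cyl_alg g ->
  exists2 h, cyl_alg h & forall x, val h x = p.[val g x].
Proof.
have [_ [E0 ED] EZ EM _] := cyl_alg_subalg => Eg.
elim/poly_ind: p => [|p k [h Eh hp]]; first by exists 0 => // x; rewrite horner0.
exists (k *: onelinf X + h ** g) => [|x].
  by apply: ED; [apply: EZ; exact: cyl_alg_one|exact: EM].
by rewrite linfty_linE linfty_mulE hp onelinfE mulr1 hornerMXaddC addrC.
Qed.

(* [fibn] takes finitely many values, so every function of it is a polynomial
   in it. *)
Lemma cyl_alg_fun_fibn psi : cyl_alg (fun_fibn psi).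
Proof.
pose N := #|a|.+1; pose s k : R[i] := k%:R.
have s_inj : injective s by move=> i j /eqP; rewrite eqr_nat => /eqP.
(* Lagrange interpolation of [psi] at the nodes 0, ..., #|a|, which contain all values of [fibn]. *)
pose p := \sum_(i < N) psi i *: (tnth (lagrange N s) i : {poly R[i]}).
have [h Eh hp] : exists2 h, cyl_alg h & forall x, val h x = (fibn x)%:R.
  exists (\sum_c branch c (onelinf X)) => [|x].
    apply: cstar_subalg_sum; first exact: cyl_alg_subalg.
    by move=> c _; apply: cyl_alg_branch; exact: cyl_alg_one.
  by rewrite linfty_sumE fibnE.
have [q Eq qp] := cyl_alg_poly p Eh.
suff -> : fun_fibn psi = q by [].
apply: linftyP => x; rewrite qp hp -[LHS]/(psi (fibn x)) horner_sum.
have nx : (fibn x < N)%N by rewrite ltnS fibn_le.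
rewrite (bigD1 (Ordinal nx))//= big1 => [|i ni].
  rewrite addr0 hornerZ -[(fibn x)%:R]/(s (Ordinal nx)).
  by rewrite lagrange_sample// eqxx mulr1.
rewrite hornerZ -[(fibn x)%:R]/(s (Ordinal nx)) lagrange_sample//.
by rewrite (negbTE ni) mulr0.
Qed.

Lemma cyl_alg_transfer f : cyl_alg f -> cyl_alg (transfer_linfty f).
Proof.
have [_ _ _ EM _] := cyl_alg_subalg => Ef.
have -> : transfer_linfty f =
    fun_fibn (fun n => n%:R^-1) ** \sum_c branch c f.
  by apply: linftyP => x; rewrite transferE linfty_mulE linfty_sumE.
apply: EM; first exact: cyl_alg_fun_fibn.
apply: cstar_subalg_sum; first exact: cyl_alg_subalg.
by move=> c _; exact: cyl_alg_branch.
Qed.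

(** A compactness argument: a word is [good] if f is within e/2 of some element of [cyl_alg] on its
    cylinder. As [cyl_alg] is closed, it is enough that the empty word is good for every e. *)
Lemma cyl_alg_cont f : contX f -> cyl_alg f.
Proof.
move=> cf; have [Ecl [E0 ED] EZ EM _] := cyl_alg_subalg.
apply: Ecl => U; rewrite -nbhs_ballE => -[[e e'] /=].
rewrite ltcE /= => /andP[/eqP -> e0 eU].
pose good w := exists2 g, cyl_alg g & forall x, mkseq (val x) (size w) = w ->
  normc (val f x - val g x) <= e / 2.
have e20 : 0 < e / 2 by rewrite divr_gt0.
suff [g Eg fg] : good [::].
  exists g; split=> //; apply: eU; rewrite -ball_normE /= linfty_normE ltcR.
  apply: (@le_lt_trans _ _ (e / 2)); last by rewrite ltr_pdivrMr// ltr_pMr// ltr1n.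
  by apply: supnorm_le => [|x]; [exact: ltW|exact: fg].
(* The approximants of the one-letter extensions are glued with the disjoint indicators of their
   cylinders. *)
have good_split w : (forall c, good (rcons w c)) -> good w.
  move=> gw; pose g c := s2val (cid2 (gw c)).
  have gE c : cyl_alg (g c) := s2valP (cid2 (gw c)).
  have gP c := s2valP' (cid2 (gw c)) : forall x,
    mkseq (val x) (size (rcons w c)) = rcons w c ->
    normc (val f x - val (g c) x) <= e / 2.
  exists (\sum_c indX (cyl [::] (rcons w c)) ** g c).
    apply: cstar_subalg_sum; first exact: cyl_alg_subalg.
    by move=> c _; apply: EM => //; exact: cyl_alg_ind.
  move=> x xw; pose c := val x (size w).
  have xwc d : (mkseq (val x) (size (rcons w d)) == rcons w d) = (c == d).
    by rewrite size_rcons mkseqS xw eqseq_rcons eqxx.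
  rewrite linfty_sumE (bigD1 c)// big1 => [|d /andP[_ dc]].
    rewrite Monoid.mulm1 linfty_mulE indXE cyl_prefixP xwc eqxx mul1r.
    by apply: gP; apply/eqP; rewrite xwc.
  by rewrite linfty_mulE indXE cyl_prefixP xwc eq_sym (negbTE dc) mul0r.
(* Koenig's lemma: since bad words extend to bad words, there is an infinite word z
   all of whose prefixes are bad; it lies in X, where f is continuous. *)
apply: contrapT => bad0.
have badS w : ~ good w -> exists c, ~ good (rcons w c).
  by move=> bw; apply/existsNP => gw; apply: bw; exact: good_split.
(* A bad word has an extension, so there is a letter [c0], used below as a default. *)
have [c0 _] := badS _ bad0.
have /choice[next nextP] w : exists c, ~ good w -> ~ good (rcons w c).
  by have [gw|/badS[c bc]] := pselect (good w); [exists c0|exists c].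
pose W n := iter n (fun w => rcons w (next w)) [::].
pose z : onesided a := fun n => next (W n).
have zW n : mkseq z n = W n by elim: n => [//|n IH]; rewrite mkseqS IH.
have badW n : ~ good (W n) by elim: n => [//|n IH]; exact: nextP.
(* On a bad cylinder no constant k approximates f, which gives the points y k n. The constant stays
   free because f can be evaluated at z only once z is known to lie in X. *)
have [y yP] : exists y : R[i] -> nat -> X, forall k n,
    mkseq (val (y k n)) n = mkseq z n /\ ~ normc (val f (y k n) - k) <= e / 2.
  suff H (kn : R[i] * nat) : exists x : X, mkseq (val x) kn.2 = mkseq z kn.2 /\
      ~ normc (val f x - kn.1) <= e / 2.
    have [y yP] := choice H; exists (fun k n => y (k, n)) => k n.
    exact: (yP (k, n)).
  case: kn => k n /=; apply: contrapT => nox; apply: (badW n).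
  exists (k *: onelinf X); first by apply: EZ; exact: cyl_alg_one.
  move=> x; rewrite -zW size_mkseq => xz; apply: contrapT => fx; apply: nox.
  exists x; split=> //; move: fx; apply: contra_not.
  by rewrite -[val (k *: _) x]/(k * 1) mulr1.
have yz k n i : (i < n)%N -> val (y k n) i = z i.
  move=> ni; have [/(congr1 (fun s => nth c0 s i)) + _] := yP k n.
  by rewrite !nth_mkseq.
(* Any constant serves here, since only the prefixes of the points matter. *)
have Xz : shift_set X z.
  apply: (@closed_cvg _ _ \oo _ (fun n => val (y 0 n) : onesided a) _
    (@shift_closed a X) _ z (cvg_agree (yz 0))).
  by apply: nearW => n; exact: set_mem (valP (y 0 n)).
pose zX : X := exist _ z (mem_set Xz).
have yzX : y (val f zX) @ \oo --> zX by apply: cvg_agreeX; exact: yz.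
have e20' : 0 < (e / 2)%:C by rewrite ltcR.
have fy : (val f (y (val f zX) n) : R[i]^o) @[n --> \oo] --> (val f zX : R[i]^o).
  exact: (cvg_comp _ _ yzX (cf zX)).
(* With k = f z, the points converge to z while their values stay more than e/2 away from f z. *)
have := @cvgr_dist_lt _ _ _ _ _ _ _ fy _ e20'.
case=> n _ /(_ n (leqnn n)) /=; rewrite distrC normcC ltcR => /ltW.
by have [] := yP (val f zX) n.
Qed.

Theorem DX_set_cyl_alg : DX_set R X `<=` cyl_alg.
Proof.
apply: smallest_sub; last exact: cyl_alg_cont.
by split; [exact: cyl_alg_subalg|exact: cyl_alg_endo|exact: cyl_alg_transfer].
Qed.

End Branch.

(** Closedness is the point: limits stay in S because S is closed, and the subtype carries the norm
    of A. *)
Lemma csub_image_subalg {R : realType} {A : cstarType R} (S : csub A)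
    (P : set (csub_type S)) :
  cstar_subalg P -> cstar_subalg ([set val x | x in P]).
Proof.
move=> [Pcl [P0 PD] PZ PM PS]; split.
- move=> b clb; have Sb : csub_set S b.
    have [Scl _ _ _ _] := csubP S; apply: Scl; apply: closure_subset clb.
    by move=> _ [x _ <-]; exact: set_mem (valP x).
  pose x : csub_type S := exist _ b (mem_set Sb).
  exists x => //; apply: Pcl => U; rewrite -nbhs_ballE => -[e /= e0 eU].
  have [_ [[y Py <-] yb]] := clb _ (nbhsx_ballx b e e0).
  by exists y; split=> //; apply: eU; move: yb; rewrite -!ball_normE.
- split; first by exists 0.
  by move=> _ _ [x Px <-] [y Py <-]; exists (x + y) => //; exact: PD.
- by move=> k _ [x Px <-]; exists (k *: x) => //; exact: PZ.
- by move=> _ _ [x Px <-] [y Py <-]; exists (x ** y) => //; exact: PM.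
- by move=> _ [x Px <-]; exists (star x) => //; exact: PS.
Qed.

(** * Generation of D_X, and pointwise identities for branches and weights *)

Section DXidentities.
Context {R : realType} {a : finType} (X : shift_space a).
Local Notation D := (DX R X).
Local Notation ev f x := (val (val (f : D)) x).
Implicit Types (f g : D) (c : a) (u v : seq a) (x y z : X).

Lemma cyl_alg_DX_set : @cyl_alg R a X `<=` DX_set R X.
Proof.
apply: cstar_gen_sub; first exact: DX_subalg.
by move=> _ [u [v ->]]; exact: DX_cyl.
Qed.

(** Induction principle for D_X; P is later an equaliser of continuous maps or a preimage under a
    *-homomorphism. *)
Theorem DX_gen (P : set D) :
  cstar_subalg P -> (forall u v, P (indC R X u v)) -> forall f, P f.
Proof.
move=> Psub PE f; have cylP : @cyl_alg R a X `<=` [set val g | g in P].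
  apply: cstar_gen_sub; first exact: csub_image_subalg.
  by move=> _ [u [v ->]]; exists (indC R X u v).
have [g Pg gf] := cylP _ (DX_set_cyl_alg (DXvalP f)).
by have <- : g = f by exact: val_inj.
Qed.

Lemma branch_DX c f : DX_set R X (branch c (val f)).
Proof.
by apply: cyl_alg_DX_set; apply: cyl_alg_branch; apply: DX_set_cyl_alg; exact: DXvalP.
Qed.

Definition brX c f : D := mkDX (branch_DX c f).

Lemma fun_fibn_DX psi : DX_set R X (fun_fibn X psi).
Proof. by apply: cyl_alg_DX_set; exact: cyl_alg_fun_fibn. Qed.

Definition fibX psi : D := mkDX (fun_fibn_DX psi).

Lemma DX_mulC f g : f ** g = g ** f.
Proof. by apply: DXP => x; rewrite !ev_mul mulrC. Qed.

Lemma brXP c x :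
  (exists2 y, val y = scons c (val x) & forall f, ev (brX c f) x = ev f y) \/
  (forall f, ev (brX c f) x = 0).
Proof.
have [[y yx yE]|[_ yE]] := branchP (R := R) c x; [left|right].
  by exists y => // f; exact: yE.
by move=> f; exact: yE.
Qed.

Lemma brX_star_hom c : star_hom (brX c).
Proof.
by split=> [k f g|f g|f]; apply: DXP => x;
  rewrite ?(ev_lin, ev_mul, ev_star); have [[y _ fy]|fy] := brXP c x;
  rewrite !fy ?(ev_lin, ev_mul, ev_star) ?mulr0 ?addr0 ?conjc0.
Qed.

Lemma DX_unitC : is_cunit (indC R X [::] [::]).
Proof.
move=> f; suff e1 : indC R X [::] [::] = mkDX (@DX_one R a X).
  by split; rewrite e1; apply: DXP => x; rewrite ev_mul ?mul1r ?mulr1.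
by apply: val_inj; exact: indX_cyl0.
Qed.

Local Notation oneX := (indC R X [::] [::]).
Local Notation proj c := (indC R X [::] [:: c]).

Lemma ev_one x : ev oneX x = 1.
Proof. by rewrite -[LHS]/(val (indX _) x) indX_cyl0. Qed.

Lemma ev_proj c x : ev (proj c) x = (val x 0%N == c)%:R.
Proof.
by rewrite -[LHS]/(val (indX _) x) indXE cyl_prefixP/= eqseq_cons eqxx andbT.
Qed.

Lemma ev_sum (I : Type) (r : seq I) (P : pred I) (F : I -> D) x :
  ev (\sum_(i <- r | P i) F i) x = \sum_(i <- r | P i) ev (F i) x.
Proof.
have ev0 : ev 0 x = 0 by [].
have evD f g : ev (f + g) x = ev f x + ev g x.
  by rewrite -[f]scale1r ev_lin mul1r scale1r.
elim/big_rec2: _ => [|i s g Pi <-]; [exact: ev0|exact: evD].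
Qed.

Lemma proj_sum : \sum_c proj c = oneX.
Proof.
apply: DXP => x; rewrite ev_sum ev_one (bigD1 (val x 0%N))// ev_proj eqxx.
rewrite big1 ?Monoid.mulm1// => c /andP[_]; rewrite ev_proj eq_sym.
by move/negbTE ->.
Qed.

Lemma proj_mul c d : proj c ** proj d = if c == d then proj c else 0.
Proof.
apply: DXP => x; rewrite ev_mul !ev_proj -natrM mulnb.
have [->|cd] := eqVneq c d; first by rewrite ev_proj andbb.
by case: eqP => // ->; rewrite (negbTE cd).
Qed.

Lemma proj_alpha_indC c u v :
  proj c ** alphaX (indC R X u v) = indC R X u (c :: v).
Proof.
apply: DXP => x; rewrite ev_mul ev_proj ev_alpha.
by rewrite -[RHS]/(val (indX _) x) indXE cyl_cons -natrM mulnb.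
Qed.

Lemma brX_indC0 c u : brX c (indC R X u [::]) = indC R X (rcons u c) [::].
Proof. by apply: val_inj; exact: branch_cyl0. Qed.

Lemma brX_indC c d u v : brX c (indC R X u (d :: v)) =
  if c == d then indC R X [:: c] [::] ** indC R X u v else 0.
Proof.
by apply: val_inj; rewrite [LHS](branch_cyl (R := R) X c d u v); case: ifP.
Qed.

Lemma indC_idem u v : indC R X u v ** indC R X u v = indC R X u v.
Proof.
apply: DXP => x; rewrite ev_mul -[X in X * X]/(val (indX _) x).
by rewrite -[RHS]/(val (indX _) x) indXE -natrM mulnb andbb.
Qed.

Lemma alphaX_one : alphaX oneX = oneX.
Proof. by apply: DXP => x; rewrite ev_alpha !ev_one. Qed.

Lemma brX_one c : brX c oneX = indC R X [:: c] [::].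
Proof. exact: brX_indC0. Qed.

Lemma brX_alpha c f : brX c (alphaX f) = brX c oneX ** f.
Proof.
apply: DXP => x; rewrite ev_mul.
have [[y yx yE]|yE] := brXP c x.
  rewrite [LHS]yE [X in X * _]yE ev_one mul1r.
  rewrite -[LHS]/(ev f (shift_on y)); congr (val (val f) _).
  by apply: val_inj; rewrite /= yx.
by rewrite [LHS]yE [X in X * _]yE mul0r.
Qed.

(** The point dx starts with d, so the factor [proj c] removes every branch except c. *)
Lemma brX_sum_proj c f x :
  \sum_d ev (brX d (f ** proj c)) x = ev (brX c f) x.
Proof.
rewrite (bigD1 c)// big1 => [|d /andP[_ dc]]; last first.
  have [[y yx yE]|yE] := brXP d x; rewrite [LHS]yE//.
  by rewrite ev_mul ev_proj yx /= (negbTE dc) mulr0.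
rewrite Monoid.mulm1.
have [[y yx yE]|yE] := brXP c x; rewrite [LHS]yE [RHS]yE//.
by rewrite ev_mul ev_proj yx /= eqxx mulr1.
Qed.

Definition rootn (n : nat) : R[i] := (Num.sqrt n%:R)%:C.

Lemma rootn_sqr n : rootn n * rootn n = n%:R.
Proof. by rewrite -rmorphM -expr2 sqr_sqrtr ?ler0n// rmorph_nat. Qed.

Lemma rootn_conj n : (rootn n)^*%C = rootn n.
Proof. exact: conjc_real. Qed.

Lemma rootn_neq0 n : (0 < n)%N -> rootn n != 0.
Proof.
move=> n0; apply: contraTneq (ltn0Sn 0) => r0.
have : n%:R = 0 :> R[i] by rewrite -rootn_sqr r0 mulr0.
by move/eqP; rewrite pnatr_eq0 => /eqP n0'; rewrite n0' in n0.
Qed.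

(** The fibre over the shift of x contains x; hence the weights are invertible. *)
Lemma fibn_shift_gt0 x : (0 < fibn (shift_on x))%N.
Proof.
rewrite /fibn cardfs_gt0; apply/fset0Pn; exists x.
by rewrite in_fset_set ?inE//; exact: fiber_finite.
Qed.

(* [wt] is the square root of m(x) = #(sigma^-1(sigma x)); S_c is
   [wt] 1_(C(eps,c)) S. *)
Definition wt : D := alphaX (fibX rootn).
Definition wti : D := alphaX (fibX (fun n => (rootn n)^-1)).

Lemma ev_wt x : ev wt x = rootn (fibn (shift_on x)).
Proof. by []. Qed.

Lemma ev_wti x : ev wti x = (rootn (fibn (shift_on x)))^-1.
Proof. by []. Qed.

Lemma wt_star : star wt = wt.
Proof. by apply: DXP => x; rewrite ev_star ev_wt; exact: rootn_conj. Qed.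

Lemma wti_star : star wti = wti.
Proof.
apply: DXP => x; rewrite ev_star ev_wti /rootn -fmorphV; exact: conjc_real.
Qed.

Lemma wti_wt : wti ** wt = oneX.
Proof.
apply: DXP => x; rewrite ev_mul ev_one ev_wt ev_wti mulVf//.
by rewrite rootn_neq0// fibn_shift_gt0.
Qed.

Lemma proj_star c : star (proj c) = proj c.
Proof.
by apply: DXP => x; rewrite ev_star ev_proj; exact: conjc_nat.
Qed.

Lemma ev_transferX f x :
  ev (transferX f) x = (fibn x)%:R^-1 * \sum_c ev (brX c f) x.
Proof. exact: transferE. Qed.

Lemma fibnE_shift c x y : val y = scons c (val x) ->
  ev wt y = rootn (fibn x) /\ ev wti y = (rootn (fibn x))^-1.
Proof.
move=> yx; have -> : x = shift_on y by apply: val_inj; rewrite /= yx.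
by [].
Qed.

Lemma transferX_proj c f x :
  ev (transferX (f ** proj c)) x = (fibn x)%:R^-1 * ev (brX c f) x.
Proof. by rewrite ev_transferX brX_sum_proj. Qed.

(** At cx the weight is the root of the number of preimages of x, so its two occurrences cancel the
    averaging factor of L. *)
Lemma transferX_wt_proj c f :
  transferX ((wt ** proj c) ** f ** (wt ** proj c)) = brX c f.
Proof.
have -> : (wt ** proj c) ** f ** (wt ** proj c) = wt ** f ** wt ** proj c.
  apply: DXP => x; rewrite !ev_mul ev_proj.
  by case: eqP => _; rewrite ?mulr0 ?mulr1 ?mul0r.
apply: DXP => x; rewrite transferX_proj.
have [[y yx yE]|yE] := brXP c x; rewrite [RHS]yE [X in _ * X]yE ?mulr0//.
have [wy _] := fibnE_shift yx; rewrite !ev_mul wy mulrAC rootn_sqr mulrA mulVf ?mul1r//.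
rewrite pnatr_eq0 -lt0n (_ : x = shift_on y) ?fibn_shift_gt0//.
by apply: val_inj; rewrite /= yx.
Qed.

(** On C(eps, c) the point z is the only preimage of its shift starting with c, so averaging only
    divides by m(z), and the two roots cancel that. This identity is behind [wt_redundancy]. *)
Lemma wt_proj_alpha_transferX c f :
  (wt ** proj c) ** alphaX (transferX ((wt ** proj c) ** f)) = proj c ** f.
Proof.
have -> : (wt ** proj c) ** f = wt ** f ** proj c.
  by rewrite -!cmulA (DX_mulC f).
apply: DXP => z; rewrite !ev_mul ev_proj ev_alpha transferX_proj.
case: eqP => [zc|_]; last by rewrite mulr0 !mul0r.
rewrite (@branchE R a X c _ (shift_on z) z); last first.
  by apply/funext => -[|i].
rewrite !ev_mul ev_wt mulr1 mul1r; set r := rootn _.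
have r0 : r != 0 by rewrite rootn_neq0// fibn_shift_gt0.
rewrite -rootn_sqr -/r invfM !mulrA mulfV// mul1r mulVf// mul1r//.
Qed.

(** Here the two inverse roots supply the averaging factor; [rep_covariant] uses this form. *)
Lemma transferX_brX f : transferX f = \sum_c brX c (wti ** f ** wti).
Proof.
apply: DXP => x; rewrite ev_transferX ev_sum mulr_sumr; apply: eq_bigr => c _.
have [[y yx yE]|yE] := brXP c x; rewrite [RHS]yE [X in _ * X]yE ?mulr0//.
have [_ wy] := fibnE_shift yx; rewrite !ev_mul wy mulrAC -invfM rootn_sqr//.
Qed.

End DXidentities.

(** * The family in the crossed product *)

Section Family.
Context {R : realType} {a : finType} (X : shift_space a).
Context {Q : cstarType R} (j : DX R X -> Q) (s : Q).
Local Notation D := (DX R X).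
Local Notation oneX := (indC R X [::] [::]).
Local Notation proj c := (indC R X [::] [:: c]).
Local Notation wt := (wt (R := R) X).
Local Notation wti := (wti (R := R) X).
Hypothesis jh : star_hom j.
Hypothesis jU : is_cunit (j oneX).
Hypothesis js : forall f, s ** j f = j (alphaX f) ** s.
Hypothesis sjs : forall f, star s ** j f ** s = j (transferX f).
Hypothesis js_redundancy : forall c f,
  j (wt ** proj c ** alphaX f) ** s ** star s ** j (wt ** proj c) =
  j (proj c ** alphaX f).

Definition letS c : Q := j (wt ** proj c) ** s.

Definition famS (u : seq a) : Q := foldr (fun c t => letS c ** t) (j oneX) u.

Lemma wt_proj_star c : star (wt ** proj c) = wt ** proj c.
Proof. by rewrite starM wt_star proj_star DX_mulC. Qed.

Lemma letS_star c : star (letS c) = star s ** j (wt ** proj c).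
Proof. by rewrite starM -(star_homS jh) wt_proj_star. Qed.

Lemma letS_star_mul c f : star (letS c) ** j f ** letS c = j (brX c f).
Proof.
rewrite letS_star /letS -!cmulA (cmulA (j _) (j _)) -(star_homM jh).
rewrite (cmulA (j _) (j _)) -(star_homM jh) cmulA sjs.
by rewrite -transferX_wt_proj.
Qed.

Lemma letS_mul_star c f :
  letS c ** j f ** star (letS c) = j (proj c ** alphaX f).
Proof.
rewrite letS_star /letS -(cmulA (j _) s) js !cmulA -(star_homM jh).
exact: js_redundancy.
Qed.

Lemma famS_cat u v : famS u ** famS v = famS (u ++ v).
Proof.
by elim: u => [|c u IH] /=; [exact: (jU _).1|rewrite -cmulA IH].
Qed.

Lemma famS1 c : famS [:: c] = letS c.
Proof. exact: (jU _).2. Qed.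

(** Induction on the last letter: S_(uc)^* S_(uc) = S_c^* (S_u^* S_u) S_c, which [letS_star_mul]
    turns into a branch. *)
Lemma famS_star_mul u : star (famS u) ** famS u = j (indC R X u [::]).
Proof.
elim/last_ind: u => [|u c IH].
  by rewrite (cunit_star jU) (jU _).1.
rewrite -cats1 -famS_cat famS1 starM -!cmulA (cmulA (star (famS u))) IH.
by rewrite cmulA letS_star_mul brX_indC0 cats1.
Qed.

(** Induction on v from its first letter: conjugating by S_c prepends c to v, by [letS_mul_star]. *)
Lemma famS_mul_star u v :
  famS v ** star (famS u) ** famS u ** star (famS v) = j (indC R X u v).
Proof.
rewrite -(cmulA (famS v)) famS_star_mul.
elim: v => [|c v IH] /=; first by rewrite (cunit_star jU) (jU _).1 (jU _).2.
rewrite starM cmulA -!(cmulA (letS c)) IH.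
by rewrite cmulA letS_mul_star proj_alpha_indC.
Qed.

Lemma famS_partial_isometry u : partial_isometry (famS u).
Proof.
apply: proj_partial_isometry (famS_star_mul u) _.
by rewrite -(star_homM jh) indC_idem.
Qed.

Lemma cstar_gen_famS f : cstar_gen (range famS) (j f).
Proof.
apply: (DX_gen (star_hom_preimage jh (@DX_unitC R a X)
  (cstar_gen_subalg (range famS)))) => u v /=.
have [_ _ _ GM Gs] := cstar_gen_subalg (range famS).
have GS w : cstar_gen (range famS) (famS w) by apply: sub_cstar_gen; exists w.
rewrite -famS_mul_star.
exact: (GM _ _ (GM _ _ (GM _ _ (GS v) (Gs _ (GS u))) (GS u)) (Gs _ (GS v))).
Qed.

Lemma cstar_gen_famS_s : cstar_gen (range famS) s.
Proof.
have [_ _ _ GM _] := cstar_gen_subalg (range famS).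
have -> : s = j wti ** \sum_c famS [:: c].
  under eq_bigr do rewrite famS1 /letS.
  rewrite -cmul_suml cmulA -star_hom_sum// -(star_homM jh) -cmul_sumr cmulA.
  by rewrite wti_wt proj_sum (DX_unitC _).1 (jU s).1.
apply: GM; first exact: cstar_gen_famS.
apply: cstar_subalg_sum; first exact: cstar_gen_subalg.
by move=> c _; apply: sub_cstar_gen; exists [:: c].
Qed.

Lemma famS_shift_rep : shift_rep X famS.
Proof.
split; [exact: famS_partial_isometry|exact: famS_cat|].
exists j; split=> // [_ [f _ <-]|u v]; first exact: cstar_gen_famS.
by rewrite famS_mul_star.
Qed.

End Family.

(** * Redundancies and the quotient of the Toeplitz algebra *)

Section Quotient.
Context {R : realType} {a : finType} (X : shift_space a).
Context {T Q : cstarType R} (i : DX_system R X -> T) (S : T) (p : T -> Q).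
Hypothesis iT : is_toeplitz i S.
Hypothesis pQ : is_quotient (redundancy_ideal i S) p.
Local Notation oneX := (indC R X [::] [::]).
Local Notation proj c := (indC R X [::] [:: c]).
Local Notation wt := (wt (R := R) X).

Lemma sub_closed_span (A : cstarType R) (G : set A) : G `<=` closed_span G.
Proof. by move=> x Gx V [_]; apply. Qed.

(** The second entry is a single generator of the closed span. Applied to i(b) S, it gives i(wt proj
    alpha(f) alpha(L(wt proj b))) S by the Toeplitz relations, and [wt_proj_alpha_transferX]
    simplifies the coefficient. *)
Lemma wt_redundancy c (f : DX R X) : redundancy i S (proj c ** alphaX f)
  (i (wt ** proj c ** alphaX f) ** S ** star S ** i (wt ** proj c)).
Proof.
have [[[_ iM _] _ iS SiS] _ _] := iT.
split.
  by apply: sub_closed_span; exists (wt ** proj c ** alphaX f), (wt ** proj c).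
move=> b; rewrite -iM -(cmulA _ (i _) (i b)) -iM -(cmulA _ (i _) S).
rewrite -(cmulA _ (star S)) (cmulA (star S)) SiS -(cmulA _ S) iS.
rewrite (cmulA (i _) (i _) S) -iM; congr (i _ ** S).
rewrite !(DX_mulC _ (alphaX f)) -!(cmulA (alphaX f)); congr (_ ** _).
exact/esym/wt_proj_alpha_transferX.
Qed.

(** Since alpha(1) = 1, every x equals x alpha(1) 1 and thus meets the restriction on redundancies
    in the definition of the ideal. *)
Lemma quotient_redundancy x k : redundancy i S x k -> p (i x) = p k.
Proof.
have [ph _ pJ] := pQ => xk; apply/eqP; rewrite -subr_eq0 -(star_homB ph).
apply/eqP/pJ => J [_]; apply; exists x, k; split=> //.
apply: sub_closed_span; exists x, oneX, oneX.
rewrite -[exel_endo _]/(alphaX _) alphaX_one.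
by rewrite !(DX_unitC _).2.
Qed.

Lemma toeplitz_unit : is_cunit (i oneX).
Proof. by have [[_ iU _ _] _ _] := iT; apply: iU; exact: DX_unitC. Qed.

Lemma quotient_unit : is_cunit (p (i oneX)).
Proof.
have [ph pT _] := pQ => q; have [t _ <-] : range p q by rewrite pT.
by rewrite -!(star_homM ph) (toeplitz_unit t).1 (toeplitz_unit t).2.
Qed.

Lemma quotient_star_hom : star_hom (p \o i).
Proof.
have [ph _ _] := pQ; have [[ih _ _ _] _ _] := iT.
split=> [k f g|f g|f] /=.
- by rewrite (star_homD ih) (star_homZ ih) (star_homD ph) (star_homZ ph).
- by rewrite (star_homM ih) (star_homM ph).
- by rewrite (star_homS ih) (star_homS ph).
Qed.

Local Notation j := (p \o i).
Local Notation s := (p S).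

Lemma quotient_intertwine f : s ** j f = j (alphaX f) ** s.
Proof.
have [ph _ _] := pQ; have [[_ _ iS _] _ _] := iT.
by rewrite /= -!(star_homM ph) iS.
Qed.

Lemma quotient_transfer f : star s ** j f ** s = j (transferX f).
Proof.
have [ph _ _] := pQ; have [[_ _ _ SiS] _ _] := iT.
by rewrite /= -(star_homS ph) -!(star_homM ph) SiS.
Qed.

Lemma quotient_wt_redundancy c f :
  j (wt ** proj c ** alphaX f) ** s ** star s ** j (wt ** proj c) =
  j (proj c ** alphaX f).
Proof.
have [ph _ _] := pQ; rewrite /= -(star_homS ph) -!(star_homM ph).
by rewrite -(quotient_redundancy (wt_redundancy c f)).
Qed.

Lemma crossed_product_gen (G : set Q) : cstar_subalg G ->
  (forall f, G (j f)) -> G s -> G = setT.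
Proof.
have [ph pT _] := pQ; have [_ iT_gen _] := iT => Gsub Gj Gs.
have Gp : cstar_subalg (p @^-1` G) := star_hom_preimage ph toeplitz_unit Gsub.
apply/seteqP; split=> // q _; have [t _ <-] : range p q by rewrite pT.
have : cstar_gen (range i `|` [set S]) t by rewrite iT_gen.
by move: t; apply: cstar_gen_sub Gp _ => t [[f _ <-]|->]; [exact: Gj|exact: Gs].
Qed.

End Quotient.

(** * Universality *)

(** Preimages under p are chosen; F does not depend on the choice because it vanishes on the kernel
    of p. *)
Lemma star_hom_factor {R : realType} {T Q B : cstarType R}
    (p : T -> Q) (F : T -> B) :
  star_hom p -> range p = setT -> star_hom F ->
  (forall t, p t = 0 -> F t = 0) ->
  exists psi : Q -> B, star_hom psi /\ forall t, psi (p t) = F t.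
Proof.
move=> ph pT Fh pF0.
have /choice[r pr] q : exists t, p t = q.
  by have [t _ <-] : range p q by [rewrite pT]; exists t.
have FE t t' : p t = p t' -> F t = F t'.
  move=> ptt'; apply/eqP; rewrite -subr_eq0 -(star_homB Fh) pF0//.
  by rewrite (star_homB ph) ptt' subrr.
exists (F \o r); split=> [|t]; last by apply: FE; rewrite pr.
split=> [k q q'|q q'|q] /=.
- rewrite -(star_homZ Fh) -(star_homD Fh); apply: FE.
  by rewrite (star_homD ph) (star_homZ ph) !pr.
- by rewrite -(star_homM Fh); apply: FE; rewrite (star_homM ph) !pr.
- by rewrite -(star_homS Fh); apply: FE; rewrite (star_homS ph) !pr.
Qed.

Section ShiftRep.
Context {R : realType} {a : finType} (X : shift_space a).
Context {B : cstarType R} (s : seq a -> B) (phi : DX R X -> B).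
Local Notation D := (DX R X).
Local Notation oneX := (indC R X [::] [::]).
Local Notation proj c := (indC R X [::] [:: c]).
Local Notation wt := (wt (R := R) X).
Local Notation wti := (wti (R := R) X).
Hypothesis s_pi : forall u, partial_isometry (s u).
Hypothesis s_cat : forall u v, s u ** s v = s (u ++ v).
Hypothesis phih : star_hom phi.
Hypothesis phiE : forall u v,
  phi (indC R X u v) = s v ** star (s u) ** s u ** star (s v).
Hypothesis s_gen : cstar_gen (range s) = setT.

Lemma rep_nil_star : star (s [::]) = s [::].
Proof. exact: (idem_partial_isometry_star (s_cat [::] [::])). Qed.

(** The elements fixed by [s [::]] on both sides form a C*-subalgebra containing all s u, hence
    everything. *)
Lemma rep_unit : is_cunit (s [::]).
Proof.
move=> b; have : cstar_gen (range s) b by rewrite s_gen.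
move: b; apply: cstar_gen_sub; first exact: cunit_subalg rep_nil_star.
by move=> _ [u _ <-]; split; rewrite s_cat ?cats0.
Qed.

Lemma rep_phi_one : phi oneX = s [::].
Proof. by rewrite phiE rep_nil_star !s_cat. Qed.

Lemma rep_star_mul u : star (s u) ** s u = phi (indC R X u [::]).
Proof. by rewrite phiE rep_nil_star (rep_unit _).2 (rep_unit _).1. Qed.

Lemma rep_mul_star v : s v ** star (s v) = phi (indC R X [::] v).
Proof. by rewrite phiE rep_nil_star !(rep_unit _).2. Qed.

Lemma rep_starK u : star (s u) ** s u ** star (s u) = star (s u).
Proof. by rewrite -cmulA -[in RHS](s_pi u) starM starM starK. Qed.

Lemma rep_proj c : phi (proj c) ** s [:: c] = s [:: c].
Proof. by rewrite -rep_mul_star s_pi. Qed.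

Lemma rep_star_proj c : star (s [:: c]) ** phi (proj c) = star (s [:: c]).
Proof. by rewrite -rep_mul_star cmulA rep_starK. Qed.

(** The projections [phi (proj c)] and [phi (proj d)] are orthogonal, fix s_c and s_d respectively
    from the left, and commute with [phi f]. *)
Lemma rep_orth c d f : c != d -> star (s [:: c]) ** phi f ** s [:: d] = 0.
Proof.
move=> cd; rewrite -rep_star_proj -(rep_proj d) cmulA -(cmulA (star _)).
rewrite -(star_homM phih) -(cmulA (star _)) -(star_homM phih).
rewrite DX_mulC cmulA proj_mul eq_sym (negbTE cd) cmul0r.
by rewrite (star_hom0 phih) cmulr0 cmul0r.
Qed.

(** Both sides are continuous *-homomorphisms in f, so cylinder functions suffice; the left side is
    multiplicative because s_c s_c^* = [phi (proj c)] commutes with the image of [phi]. *)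
Lemma rep_branch c f : star (s [:: c]) ** phi f ** s [:: c] = phi (brX c f).
Proof.
move: f; apply: (DX_gen (P := [set g |
  star (s [:: c]) ** phi g ** s [:: c] = phi (brX c g)])).
  have bh := @brX_star_hom R a X c; have U := @DX_unitC R a X.
  have phic := star_hom_continuous phih U.
  split.
  - apply: closed_eqfun => g.
      apply: (@continuous_comp _ _ _ (fun g => star (s [:: c]) ** phi g)
        (fun b => b ** s [:: c])); last exact: cmul_continuousr.
      by apply: continuous_comp; [exact: phic|exact: cmul_continuousl].
    apply: continuous_comp; last exact: phic.
    exact: (star_hom_continuous bh U).
  - split; first by rewrite /= (star_hom0 bh) (star_hom0 phih) cmulr0 cmul0r.
    move=> f g /= fE gE.
    by rewrite (star_homD bh) !(star_homD phih) cmulDr cmulDl fE gE.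
  - move=> k g /= gE.
    by rewrite (star_homZ bh) !(star_homZ phih) cmulZr cmulZl gE.
  - move=> f g /= fE gE; rewrite (star_homM bh) !(star_homM phih) -fE -gE.
    rewrite !cmulA -(cmulA _ (s [:: c]) (star _)) rep_mul_star.
    rewrite -(cmulA _ (phi f) (phi (proj c))) -(star_homM phih) DX_mulC.
    rewrite (star_homM phih).
    by rewrite !cmulA rep_star_proj.
  - move=> g /= gE; rewrite (star_homS bh) !(star_homS phih) -gE.
    by rewrite !starM starK cmulA.
move=> u [|d v] /=.
  rewrite brX_indC0 -!rep_star_mul -cats1 -s_cat starM -!cmulA//.
(* For c = d, the projection s_c^* s_c appears on both sides of the image of 1_C(u,v); for distinct
   letters the term vanishes by [rep_orth]. *)
rewrite brX_indC (phiE u (d :: v)); case: eqVneq => [<-|cd].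
  transitivity (phi (indC R X [:: c] [::] ** indC R X u v ** indC R X [:: c] [::])).
    rewrite !(star_homM phih) (phiE u v) -rep_star_mul -[c :: v]cat1s -s_cat.
    by rewrite starM !cmulA.
  by rewrite DX_mulC cmulA indC_idem.
rewrite (star_hom0 phih) -[d :: v]cat1s -s_cat.
have := rep_orth oneX cd; rewrite rep_phi_one (rep_unit _).2 => cd0.
by rewrite !cmulA cd0 !cmul0r.
Qed.

(** In s_c = s_c s_c^* s_c, the factor s_c^* s_c absorbs f as [brX c (alphaX f)], which [rep_branch]
    expands; the projection s_c s_c^* then commutes past alpha(f). *)
Lemma rep_intertwine c f : s [:: c] ** phi f = phi (alphaX f) ** s [:: c].
Proof.
rewrite -[in LHS](s_pi [:: c]) -(cmulA (s _)) rep_star_mul -brX_one.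
rewrite -cmulA -(star_homM phih) -brX_alpha -rep_branch !cmulA rep_mul_star.
by rewrite -(star_homM phih) DX_mulC (star_homM phih) -cmulA rep_proj.
Qed.

Definition repS : B := phi wti ** \sum_c s [:: c].

Lemma rep_wt_proj c : phi (wt ** proj c) ** repS = s [:: c].
Proof.
rewrite cmulA -(star_homM phih) (_ : _ ** wti = proj c); last first.
  by rewrite DX_mulC cmulA wti_wt (DX_unitC _).1.
rewrite cmul_sumr (bigD1 c)//= rep_proj big1 ?addr0// => d dc.
rewrite -rep_proj cmulA -(star_homM phih) proj_mul eq_sym (negbTE dc).
by rewrite (star_hom0 phih) cmul0r.
Qed.

(** In the transfer relation the product expands over pairs of letters; [rep_orth] removes the mixed
    terms, and [rep_branch] with [transferX_brX] sums the others. *)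
Lemma rep_covariant : exel_covariant (A := DX_system R X) phi repS.
Proof.
split=> // [e eU|f|f].
- rewrite (cunit_uniq eU (@DX_unitC R a X)) rep_phi_one; exact: rep_unit.
- rewrite -[exel_endo _]/(alphaX f) /repS -cmulA cmul_suml.
  under eq_bigr do rewrite rep_intertwine.
  by rewrite -cmul_sumr !cmulA -!(star_homM phih) DX_mulC.
- rewrite -[exel_transfer _]/(transferX f) transferX_brX (star_hom_sum phih).
  rewrite /repS starM -(star_homS phih) wti_star star_sum.
  rewrite cmulA -(cmulA _ (phi wti) (phi f)) -(star_homM phih).
  rewrite -(cmulA _ (phi (wti ** f)) (phi wti)) -(star_homM phih).
  rewrite !cmul_suml; apply: eq_bigr => c _.
  rewrite cmul_sumr (bigD1 c)//= rep_branch big1 ?addr0// => d dc.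
  by rewrite rep_orth// eq_sym.
Qed.

(** Choosing b = wt proj c turns the hypothesis into phi(f) s_c = k s_c; multiply by s_c^* and sum
    over c, since the projections s_c s_c^* add up to 1. *)
Lemma rep_redundancy (f : D) (k : B) :
  (forall b, phi f ** phi b ** repS = k ** phi b ** repS) -> phi f = k.
Proof.
move=> fk; have fkp c : phi f ** phi (proj c) = k ** phi (proj c).
  rewrite -rep_mul_star !cmulA; congr (_ ** _); rewrite -rep_wt_proj.
  by rewrite (cmulA (phi f) (phi _)) (cmulA k (phi _)) fk.
rewrite -[LHS](rep_unit _).2 -[RHS](rep_unit _).2 -rep_phi_one -proj_sum.
by rewrite (star_hom_sum phih) !cmul_sumr; apply: eq_bigr.
Qed.

End ShiftRep.

Lemma closed_ideal_ker {R : realType} {T B : cstarType R} (F : T -> B) (e : T) :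
  is_cunit e -> star_hom F -> closed_ideal [set t | F t = 0].
Proof.
move=> eU Fh; split; first split.
- apply: (closed_eqfun (g := fun=> 0)); [exact: (star_hom_continuous Fh eU)|].
  by move=> t; exact: cst_continuous.
- exact: star_hom0.
- move=> k t t' /= t0 t'0.
  by rewrite (star_homD Fh) (star_homZ Fh) t0 t'0 scaler0 addr0.
by move=> t t' /= t'0; rewrite !(star_homM Fh) t'0 cmulr0 cmul0r.
Qed.

Theorem theorem8 (R : realType) (a : finType) (X : shift_space a)
    (Q : cstarType R) (hQ : is_crossed_product (DX_system R X) Q) :
  exists S : seq a -> Q, is_universal_shift_rep X S.
Proof.
have [T [i [S [p [iT pQ]]]]] := hQ.
have jh := quotient_star_hom iT pQ; have jU := quotient_unit iT pQ.
have js := quotient_intertwine iT pQ; have sjs := quotient_transfer iT pQ.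
have jr := quotient_wt_redundancy iT pQ.
pose Sf := @famS R a X Q (p \o i) (p S); exists Sf.
have Sgen := crossed_product_gen iT pQ (cstar_gen_subalg (range Sf)).
split.
- exact: famS_shift_rep jh jU js sjs jr.
- by apply: Sgen; [exact: cstar_gen_famS jh jU js sjs jr|
    exact: cstar_gen_famS_s jh jU js sjs jr].
move=> B s [s_pi s_cat [phi [phih _ phiE]]] s_gen.
(* The pair of [phi] and [repS] is covariant, so the universal Toeplitz algebra maps to B. *)
have [_ _ /(_ B phi _ (rep_covariant s_pi s_cat phih phiE s_gen))] := iT.
move=> [F [Fh Fi FS]].
have [ph pT pJ] := pQ; have TU := toeplitz_unit iT.
have [|psi [psih psip]] := @star_hom_factor _ _ _ _ p F ph pT Fh.
  (* The kernel of F is a closed ideal, and [rep_redundancy] puts every generating difference in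
     it. *)
  move=> t /pJ Jt; apply: (Jt [set t | F t = 0]).
  split; first exact: closed_ideal_ker TU Fh.
  move=> _ [f [k [_ [_ fk] ->]]] /=.
  rewrite (star_homB Fh) Fi
    (rep_redundancy s_pi s_cat phih phiE s_gen (k := F k)) ?subrr//.
  by move=> b; rewrite -!Fi -FS -!(star_homM Fh) fk.
(* Words are handled letter by letter; S_c goes to phi(wt proj c) [repS] = s_c. *)
exists psi; split=> //; elim=> [|c u IH] /=.
  by rewrite psip Fi (rep_phi_one s_pi s_cat phiE).
rewrite (star_homM psih) IH /letS /= -(star_homM ph) psip (star_homM Fh) Fi FS.
by rewrite (rep_wt_proj s_pi s_cat phih phiE)// s_cat.
Qed.
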